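(* Let $p>3$ be a prime. If $p\equiv1\pmod4$, write $p=x^2+y^2$ with integers $x,y$ and $4\mid x-1$; then $$\sum_{k=0}^{p-1}(8k+3)\binom{-3/4}k^4\equiv(-1)^{\frac{p-1}4}\Big(\frac{3p^2}{2x}+\frac{3p^3}{8x^3}\Big)\pmod{p^4}.$$ If $p\equiv3\pmod4$, then $$\sum_{k=0}^{p-1}(8k+3)\binom{-3/4}k^4\equiv(-1)^{\frac{p-3}4}p\binom{\frac{p-3}2}{\frac{p-3}4}\Big(1-p\big(1+\tfrac12q_p(2)\big)+p^2\big(\tfrac12q_p(2)+\tfrac38q_p(2)^2+\tfrac14E_{p-3}\big)\Big)\pmod{p^4}.$$
   Context: The general binomial coefficient is $\binom a0=1$, $\binom ak=a(a-1)\cdots(a-k+1)/k!$ for $k\ge1$. Congruences are in the ring of rationals with denominators prime to $p$. $q_p(2)=(2^{p-1}-1)/p$. The Euler numbers are $E_0=1$, $E_{2n-1}=0$, $E_{2n}=-\sum_{k=1}^n\binom{2n}{2k}E_{2n-2k}$ ($n\ge1$). *)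

(* Defs.v *)
From mathcomp Require Import all_boot all_order all_algebra.

Set Implicit Arguments.
Unset Strict Implicit.
Unset Printing Implicit Defensive.

Import GRing.Theory.
Local Open Scope ring_scope.

(* a (a - 1) ... (a - k + 1) / k!, the empty product for k = 0 being 1. *)
Definition gbinom (a : rat) (k : nat) : rat :=
  (\prod_(i < k) (a - i%:R)) / (k`!)%:R.

Definition p_integral (p : nat) (r : rat) : bool := coprime p `|denq r|%N.

(* a = b modulo m in the ring of p-integral rationals. *)
Definition p_congr (p m : nat) (a b : rat) : Prop :=
  [/\ p_integral p a, p_integral p b
    & exists2 c : rat, p_integral p c & a - b = m%:R * c].

Definition fermat_quotient2 (p : nat) : rat := (2%:R ^+ p.-1 - 1) / p%:R.

(* [:: E_0; E_2; ...; E_(2 n)] *)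
Fixpoint even_eulers (n : nat) : seq int :=
  if n is m.+1 then
    let s := even_eulers m in
    rcons s (- \sum_(1 <= k < n.+1) ('C(n.*2, k.*2))%:Z * s`_(n - k))
  else [:: 1].

Definition euler (n : nat) : int :=
  if odd n then 0 else (even_eulers n./2)`_(n./2).

Lemma size_even_eulers n : size (even_eulers n) = n.+1.
Proof. by elim: n => //= n IHn; rewrite size_rcons IHn. Qed.

Lemma nth_even_eulers n i :
  (i <= n)%N -> (even_eulers n)`_i = (even_eulers i)`_i.
Proof.
elim: n => [|n IHn]; first by rewrite leqn0 => /eqP->.
rewrite leq_eqVlt => /orP[/eqP-> //|lt_i_n].
by rewrite [even_eulers n.+1]/= nth_rcons size_even_eulers lt_i_n IHn.
Qed.

Lemma euler0 : euler 0 = 1.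
Proof. by []. Qed.

Lemma euler_odd n : (0 < n)%N -> euler (n.*2).-1 = 0.
Proof. by case: n => // n _; rewrite /euler doubleS /= odd_double. Qed.

Lemma euler_even n : (0 < n)%N ->
  euler n.*2 = - \sum_(1 <= k < n.+1) ('C(n.*2, k.*2))%:Z * euler (n - k).*2.
Proof.
case: n => // n _; rewrite {1}/euler odd_double doubleK.
rewrite [even_eulers n.+1]/= nth_rcons size_even_eulers ltnn eqxx.
congr (- _); apply: eq_big_nat => -[|k] // /andP[_ lt_k_n].
rewrite /euler odd_double doubleK subSS nth_even_eulers //.
exact: leq_subr.
Qed.

(* Main.v *)
(* Let n < p be determined by 4 n + 3 = p e with e = 1 or 3, put A = 3/4 and
   t = - A - n = - p e / 4.  The terms with k > n vanish modulo p^4.  Dougall's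
   terminating very-well-poised 5F4 sum, with parameters chosen so that its
   numerator and denominator factors become (A + j) ((A + j)^3 + t^3) and
   (j + 1) ((j + 1)^3 - t^3), agrees with the given sum modulo p^4 and has a
   closed form, namely a product with C(2 n, n) / 4^n as its main factor.
   If p = 3 mod 4, the rest is Gauss's lemma for 2 together with the congruence
   of sum_(j < p/4) 1/j^2 with - 4 E_(p-3) modulo p.
   If p = 4 m + 1, then C(6 m, 3 m) has to be known modulo p^3, which comes down
   to the theorem of Chowla, Dwork and Evans on C(2 m, m) modulo p^2.  For this,
   the Jacobsthal sum of x^3 - x equals - 2 (-1)^m x by Jacobsthal's two-squares
   identity, and is computed modulo p^2 by summing a polynomial that represents
   the quadratic character modulo p^2 over Teichmueller lifts. *)
From HB Require Import structures.
Require Import Defs.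
From mathcomp Require Import all_boot all_order all_algebra all_fingroup all_solvable.
From mathcomp Require Import ring lra zify.

Set Implicit Arguments.
Unset Strict Implicit.
Unset Printing Implicit Defensive.

Import Order.TTheory GRing.Theory Num.Theory.
Local Open Scope ring_scope.

(** * Congruences of p-integral rationals *)

(** Let w be a primitive cube root of unity. In the fourth power three of the four numerator
    parameters A are moved to A + t, A + w t, A + w^2 t, and well-poisedness moves the denominators
    j + 1 to j + 1 - t, j + 1 - w t, j + 1 - w^2 t. The symmetric functions of t, w t, w^2 t of
    degrees 1 and 2 vanish, so the perturbation starts at t^3, that is at p^3, while A + t = - n
    terminates the series. The closed form carries the factor - 4 t = p e. For e = 1, C(2 n, n) is
    prime to p, so the accompanying product is needed modulo p^3 and brings in the Euler number. For
    e = 3, n = 3 m and C(6 m, 3 m) supplies another p; the product is then 1 to the precision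
    needed, and only K = C(6 m, 3 m) / p modulo p^2 matters. Comparing factorials across p gives K =
    - 2 / C(2 m, m) modulo p, which is why x ends up in denominators. The Jacobsthal sum yields just
    one linear relation between C(2 m, m), C(6 m, m) and C(6 m, 3 m), so the last two are first
    expressed through C(2 m, m). *)

Definition Zloc (p : nat) : {pred rat} := fun r => p_integral p r.

Lemma Zloc_frac (p d : nat) (a : int) :
  coprime p d -> (0 < d)%N -> a%:~R / d%:R \in Zloc p.
Proof.
move=> co_p_d d_gt0; rewrite /in_mem /= /Zloc /p_integral.
set r : rat := _ / _.
have d_neq0 : d%:R != 0 :> rat by rewrite pnatr_eq0 -lt0n.
have den_neq0 : (denq r)%:~R != 0 :> rat by rewrite intr_eq0 denq_neq0.
have e : numq r * d%:Z = a * denq r.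
  apply/eqP; rewrite -(eqr_int rat) !intrM; apply/eqP.
  rewrite numqE /r mulrAC; congr (_ * _).
  by rewrite -mulrA -[(Posz d)%:~R]/(d%:R) mulVf ?mulr1.
have dvd : (`|denq r| %| d)%N.
  suff: (denq r %| d%:Z)%Z by rewrite dvdzE.
  rewrite -(@Gauss_dvdzr _ (numq r)).
    by rewrite e dvdz_mull.
  by rewrite coprimezE coprime_sym coprime_num_den.
by apply: coprime_dvdr co_p_d.
Qed.

Lemma ZlocP (p : nat) (r : rat) :
  reflect (exists a : int, exists d : nat,
             [/\ coprime p d, (0 < d)%N & r = a%:~R / d%:R]) (r \in Zloc p).
Proof.
apply: (iffP idP) => [Zr|[a [d [co_p_d d_gt0 ->]]]]; last exact: Zloc_frac.
exists (numq r), `|denq r|%N; split=> //.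
  by rewrite absz_gt0 denq_neq0.
by rewrite -{1}(divq_num_den r) -{1}absz_denq.
Qed.

Fact Zloc_subring (p : nat) : subring_closed (Zloc p).
Proof.
split.
- by rewrite -[1](divr1 1); apply: (@Zloc_frac p 1 1); rewrite ?coprimen1.
- move=> _ _ /ZlocP[a [d [cd d0 ->]]] /ZlocP[b [e [ce e0 ->]]].
  have -> : a%:~R / d%:R - b%:~R / e%:R
            = (a * e%:Z - b * d%:Z)%:~R / (d * e)%N%:R :> rat.
    rewrite natrM rmorphB !rmorphM /=.
    by field; rewrite !pnatr_eq0 -!lt0n d0 e0.
  by apply: Zloc_frac; rewrite ?coprimeMr ?cd ?ce ?muln_gt0 ?d0.
- move=> _ _ /ZlocP[a [d [cd d0 ->]]] /ZlocP[b [e [ce e0 ->]]].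
  have -> : (a%:~R / d%:R) * (b%:~R / e%:R) = (a * b)%:~R / (d * e)%N%:R :> rat.
    by rewrite natrM rmorphM mulf_div.
  by apply: Zloc_frac; rewrite ?coprimeMr ?cd ?ce ?muln_gt0 ?d0.
Qed.

HB.instance Definition _ (p : nat) :=
  GRing.isSubringClosed.Build rat (Zloc p) (@Zloc_subring p).

Lemma Zloc_natV (p n : nat) : coprime p n -> n%:R^-1 \in Zloc p.
Proof.
case: n => [|n] co; first by rewrite invr0 rpred0.
by rewrite -[_^-1]mul1r; apply: (@Zloc_frac p n.+1 1).
Qed.

(** Integrality of a and b is left out, so that congruences can be multiplied and divided by powers
    of p freely; [eqloc_congr] restores it at the end. *)
Definition eqloc (p k : nat) (a b : rat) : bool :=
  (a - b) / p%:R ^+ k \in Zloc p.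

Section Eqloc.
Variable p : nat.
Hypothesis p_prime : prime p.
Implicit Types (a b c d : rat) (k l : nat).

Local Notation P := (p%:R : rat).

Lemma primeQ_neq0 : P != 0.
Proof. by rewrite pnatr_eq0 -lt0n prime_gt0. Qed.

Lemma eqlocP k a b :
  reflect (exists2 c, c \in Zloc p & a = b + P ^+ k * c) (eqloc p k a b).
Proof.
have nz : P ^+ k != 0 by rewrite expf_neq0 ?primeQ_neq0.
apply: (iffP idP) => [Zc|[c Zc ->]].
  by exists ((a - b) / P ^+ k) => //; rewrite mulrC divfK // addrC subrK.
by rewrite /eqloc addrC addKr mulrC mulKf.
Qed.

Lemma eqloc_refl k a : eqloc p k a a.
Proof. by rewrite /eqloc subrr mul0r rpred0. Qed.

Lemma eqloc_sym k a b : eqloc p k a b -> eqloc p k b a.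
Proof. by rewrite /eqloc -opprB mulNr rpredN. Qed.

Lemma eqloc_trans k b a c : eqloc p k a b -> eqloc p k b c -> eqloc p k a c.
Proof.
rewrite /eqloc => /rpredD ab /ab; rewrite -mulrDl.
by rewrite addrA subrK.
Qed.

Lemma eqlocD k a b c d :
  eqloc p k a b -> eqloc p k c d -> eqloc p k (a + c) (b + d).
Proof.
rewrite /eqloc => /rpredD ab /ab; rewrite -mulrDl.
by rewrite addrACA opprD.
Qed.

Lemma eqlocN k a b : eqloc p k a b -> eqloc p k (- a) (- b).
Proof. by rewrite /eqloc -opprD mulNr rpredN. Qed.

Lemma eqlocB k a b c d :
  eqloc p k a b -> eqloc p k c d -> eqloc p k (a - c) (b - d).
Proof. by move=> ab cd; apply: eqlocD => //; apply: eqlocN. Qed.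

Lemma eqlocMl k a b c : c \in Zloc p -> eqloc p k a b -> eqloc p k (c * a) (c * b).
Proof. by rewrite /eqloc -mulrBr -mulrA => Zc /(rpredM Zc). Qed.

Lemma eqlocMr k a b c : c \in Zloc p -> eqloc p k a b -> eqloc p k (a * c) (b * c).
Proof. by rewrite ![_ * c]mulrC; apply: eqlocMl. Qed.

Lemma eqlocM k a b c d : b \in Zloc p -> c \in Zloc p ->
  eqloc p k a b -> eqloc p k c d -> eqloc p k (a * c) (b * d).
Proof.
move=> Zb Zc ab cd.
by apply: eqloc_trans (eqlocMr Zc ab) (eqlocMl Zb cd).
Qed.

Lemma eqlocX k a b n : a \in Zloc p -> b \in Zloc p ->
  eqloc p k a b -> eqloc p k (a ^+ n) (b ^+ n).
Proof.
move=> Za Zb ab; elim: n => [|n IHn]; first by rewrite !expr0 eqloc_refl.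
by rewrite !exprS; apply: eqlocM => //; apply: rpredX.
Qed.

Lemma eqloc_sum k (I : Type) (r : seq I) (Q : pred I) (F G : I -> rat) :
  (forall i, Q i -> eqloc p k (F i) (G i)) ->
  eqloc p k (\sum_(i <- r | Q i) F i) (\sum_(i <- r | Q i) G i).
Proof.
move=> FG; apply: (big_ind2 (fun x y => eqloc p k x y)) => //.
- exact: eqloc_refl.
- by move=> *; apply: eqlocD.
Qed.

Lemma eqloc_prod k (I : eqType) (r : seq I) (F G : I -> rat) :
  (forall i, i \in r -> [/\ F i \in Zloc p, G i \in Zloc p & eqloc p k (F i) (G i)]) ->
  eqloc p k (\prod_(i <- r) F i) (\prod_(i <- r) G i).
Proof.
move=> FG.
suff [] : [/\ \prod_(i <- r) F i \in Zloc p, \prod_(i <- r) G i \in Zloc p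
            & eqloc p k (\prod_(i <- r) F i) (\prod_(i <- r) G i)] by [].
rewrite !(big_seq_cond xpredT).
apply: (big_ind2 (fun x y => [/\ x \in Zloc p, y \in Zloc p & eqloc p k x y])).
- by rewrite rpred1 eqloc_refl.
- by move=> x1 x2 y1 y2 [? ? ?] [? ? ?]; split; rewrite ?rpredM ?eqlocM.
- by move=> i /andP[ir _]; apply: FG.
Qed.

Lemma Zloc_expP k : P ^+ k \in Zloc p.
Proof. by rewrite rpredX ?rpred_nat. Qed.

Lemma eqloc_Zloc k a b : eqloc p k a b -> b \in Zloc p -> a \in Zloc p.
Proof. by case/eqlocP=> c Zc -> Zb; rewrite rpredD ?rpredM ?Zloc_expP. Qed.

Lemma eqloc_weak l k a b : (l <= k)%N -> eqloc p k a b -> eqloc p l a b.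
Proof.
move=> le_lk /eqlocP[c Zc ->]; apply/eqlocP.
exists (P ^+ (k - l) * c); first by rewrite rpredM ?Zloc_expP.
by rewrite mulrA -exprD subnKC.
Qed.

Lemma eqloc_mulP l k a b : eqloc p k a b -> eqloc p (l + k) (P ^+ l * a) (P ^+ l * b).
Proof.
case/eqlocP=> c Zc ->; apply/eqlocP; exists c => //.
by rewrite mulrDr exprD mulrA.
Qed.

Lemma eqloc_divP l k a b : eqloc p (l + k) (P ^+ l * a) (P ^+ l * b) -> eqloc p k a b.
Proof.
have nz j : P ^+ j != 0 by rewrite expf_neq0 ?primeQ_neq0.
by rewrite /eqloc -mulrBr exprD invfM mulrACA divff ?mul1r.
Qed.

Lemma eqlocV k a b : a != 0 -> b != 0 -> a^-1 \in Zloc p -> b^-1 \in Zloc p ->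
  eqloc p k a b -> eqloc p k a^-1 b^-1.
Proof.
move=> a0 b0 Za Zb ab.
have := eqlocMl (rpredM Za Zb) (eqloc_sym ab).
by rewrite divfK // mulrAC mulVf // mul1r.
Qed.

Lemma eqloc_cancel k a b c : c != 0 -> c^-1 \in Zloc p ->
  eqloc p k (c * a) (c * b) -> eqloc p k a b.
Proof. by move=> c0 Zc /(eqlocMl Zc); rewrite !mulKf. Qed.

(** The ring is local, so units are recognized modulo p: a = b (1 + p u / d) with d prime to p, and
    d + p u is again prime to p. *)
Lemma eqloc1_unit a b : b != 0 -> b^-1 \in Zloc p -> eqloc p 1 a b ->
  b \in Zloc p -> a != 0 /\ a^-1 \in Zloc p.
Proof.
move=> b0 Zb' /eqlocP[c Zc ea] Zb.
have Zca : c / b \in Zloc p by rewrite rpredM.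
have {ea} ea : a = b * (1 + P * (c / b)) by rewrite ea; field.
case/ZlocP: Zca => u [d [co_pd d_gt0 ec]].
have d0 : d%:R != 0 :> rat by rewrite pnatr_eq0 -lt0n.
have co_p : coprimez p%:Z (d%:Z + p%:Z * u).
  by rewrite /coprimez addrC mulrC gcdzMDl.
have nz : d%:Z + p%:Z * u != 0.
  apply: contraTneq co_p => ->; rewrite coprimezE /coprime gcdn0.
  by rewrite neq_ltn prime_gt1 ?orbT.
have nzQ : (d%:Z + p%:Z * u)%:~R != 0 :> rat by rewrite intr_eq0.
have e1 : 1 + P * (c / b) = (d%:Z + p%:Z * u)%:~R / d%:R.
  by rewrite ec rmorphD rmorphM /=; field.
have nz1 : 1 + P * (c / b) != 0 by rewrite e1 mulf_neq0 ?invr_eq0.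
split; first by rewrite ea mulf_neq0.
rewrite ea invfM rpredM // e1 invfM invrK rpredM ?rpred_nat //.
set z := d%:Z + _ in co_p nz nzQ *.
have -> : z%:~R^-1 = (sgz z)%:~R / `|z|%N%:R :> rat.
  have /eqP := intEsg z; rewrite -(eqr_int rat) => /eqP.
  rewrite rmorphM /= => {1}->; rewrite invfM.
  congr (_ / _); case: sgzP nz => //= *; by rewrite ?invrN1 ?invr1 //.
by apply: Zloc_frac; rewrite ?absz_gt0 //; move: co_p; rewrite coprimezE.
Qed.

End Eqloc.

Lemma eqloc_congr (p k : nat) (a b : rat) : prime p ->
  b \in Zloc p -> eqloc p k a b -> p_congr p (p ^ k) a b.
Proof.
move=> p_pr Zb ab; split=> //; first exact: eqloc_Zloc ab Zb.
case/(eqlocP p_pr): ab => c Zc ->; exists c => //.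
by rewrite natrX addrC addKr.
Qed.

Ltac zloc :=
  repeat match goal with
  | H : is_true (?a \in _) |- is_true (?a \in _) => exact H
  | |- is_true (1 \in _) => exact: rpred1
  | |- is_true (_%:R \in _) => exact: rpred_nat
  | |- is_true (- _ \in _) => rewrite rpredN
  | |- is_true (_ + _ \in _) => apply: rpredD
  | |- is_true (_ * _ \in _) => apply: rpredM
  | |- is_true (_ ^+ _ \in _) => apply: rpredX
  end.

(** * Dougall's sum *)

Section Dougall.
Variable F : numFieldType.
Implicit Types (A s r x : F) (n k j : nat).

Definition wp_poly s r x : F := x ^+ 2 - s * x + r.

(* Ratio of consecutive terms, without the very-well-poised factor, of the
   terminating 5F4(A, 1 + A/2, b, c, - n; 1), with s = b + c and r = b c. *)
Definition dougall_factor A s r n j : F :=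
  (A + j%:R) * (j%:R ^+ 2 + s * j%:R + r) * (j%:R - n%:R)
  / (j.+1%:R * wp_poly s r (A + j.+1%:R) * (A + j.+1%:R + n%:R)).

Definition dougall_term A s r n k : F :=
  (A + 2%:R * k%:R) * \prod_(j < k) dougall_factor A s r n j.

(* The product of these factors is the Wilf-Zeilberger certificate, up to a
   rational function of k. *)
Definition wz_factor A s r n j : F :=
  (A + j%:R) * (j%:R ^+ 2 + s * j%:R + r) * (j%:R - n.+1%:R)
  / (j.+1%:R * wp_poly s r (A + j.+1%:R) * (A + n.+1%:R + j%:R)).

Variables A s r : F.
Hypothesis A_neq0 : forall j, A + j%:R != 0.
Hypothesis Q_neq0 : forall j, wp_poly s r (A + j.+1%:R) != 0.

Let S_neq0 j : j.+1%:R != 0 :> F. Proof. by rewrite pnatr_eq0. Qed.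

Let M_neq0 n j : A + n.+1%:R + j%:R != 0.
Proof. by rewrite -addrA -natrD. Qed.

Let W n k := \prod_(j < k) wz_factor A s r n j.

(** The products for n + 1 and, in the next lemma, for n are both written as [W n k] times a
    rational function; this reduces [dougall_wz] to an identity that [field] can check. *)
Lemma dougall_prod_wz_succ n k :
  \prod_(j < k) dougall_factor A s r n.+1 j
  = W n k * ((A + n.+1%:R) / (A + n.+1%:R + k%:R)).
Proof.
elim: k => [|k IHk]; first by rewrite /W !big_ord0 addr0 divff ?mulr1.
rewrite /W !big_ord_recr /= -/(W n k) IHk /dougall_factor /wz_factor.
have h1 := M_neq0 n k; have h2 := M_neq0 n k.+1; have h3 := Q_neq0 k.
have h4 := S_neq0 k; have h5 := M_neq0 n 0.
move: h1 h2 h3 h4 h5; set Q := wp_poly _ _ _; rewrite -!natr1 !mulr0n ?addr0 => *.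
by field; repeat (apply/andP; split).
Qed.

Lemma dougall_prod_wz n k :
  \prod_(j < k) dougall_factor A s r n j = W n k * ((n.+1%:R - k%:R) / n.+1%:R).
Proof.
elim: k => [|k IHk]; first by rewrite /W !big_ord0 subr0 divff ?mulr1.
rewrite /W !big_ord_recr /= -/(W n k) IHk /dougall_factor /wz_factor.
have h1 := M_neq0 n k; have h3 := Q_neq0 k.
have h4 := S_neq0 k; have h5 := S_neq0 n.
move: h1 h3 h4 h5; set Q := wp_poly _ _ _; rewrite -!natr1 => *.
by field; repeat (apply/andP; split).
Qed.

(** A first-order recurrence in n whose right-hand side is a difference in k, so that summation over
    k leaves boundary values only. *)
Lemma dougall_wz n k :
  wp_poly s r (A + n.+1%:R) * dougall_term A s r n.+1 k
  - (A + n.+1%:R) * (A + n.+1%:R - s) * dougall_term A s r n k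
  = (A + n.+1%:R) / n.+1%:R
    * (W n k * k%:R * wp_poly s r (A + k%:R)
       - W n k.+1 * k.+1%:R * wp_poly s r (A + k.+1%:R)).
Proof.
rewrite /dougall_term dougall_prod_wz_succ dougall_prod_wz.
rewrite {4}/W big_ord_recr /= -/(W n k) /wz_factor.
have h1 := M_neq0 n k; have h3 := Q_neq0 k; have h4 := S_neq0 k.
have h5 := S_neq0 n.
have cancel (u v w x y : F) : y != 0 -> x != 0 -> w != 0 ->
   u * (v / (x * y * w)) * x * y = u * (v / w) :> F.
  by move=> *; field; repeat (apply/andP; split).
rewrite cancel //.
rewrite /wp_poly; move: h1 h3 h4 h5; rewrite -!natr1 => *; field.
by repeat (apply/andP; split).
Qed.
Lemma dougall_sum n :
  \sum_(k < n.+1) dougall_term A s r n k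
  = A * \prod_(j < n) ((A + j.+1%:R) * (A + j.+1%:R - s)
                       / wp_poly s r (A + j.+1%:R)).
Proof.
elim: n => [|n IHn].
  by rewrite big_ord_recl !big_ord0 /dougall_term big_ord0 mulr0 addr0 addr0.
rewrite [X in _ = A * X]big_ord_recr /= mulrA -{}IHn.
(* The added term k = n + 1 is zero: its factor j = n contains j - n. *)
have -> : \sum_(k < n.+1) dougall_term A s r n k
          = \sum_(k < n.+2) dougall_term A s r n k.
  rewrite [RHS]big_ord_recr /=.
  rewrite [dougall_term A s r n n.+1]/dougall_term [\prod_(j < _) _]big_ord_recr /=.
  by rewrite [dougall_factor A s r n n]/dougall_factor subrr !(mulr0, mul0r) addr0.
apply: (mulfI (Q_neq0 n)); rewrite mulrCA [X in _ = _ * X]mulrC divfK //.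
apply/eqP; rewrite [eqbRHS]mulrC -subr_eq0; apply/eqP.
rewrite !mulr_sumr -sumrB.
under eq_bigr do rewrite dougall_wz.
rewrite -mulr_sumr.
pose w k := W n k * k%:R * wp_poly s r (A + k%:R).
rewrite -(big_mkord xpredT (fun k => w k - w k.+1)).
under eq_bigr do rewrite -opprB.
(* The certificate vanishes at k = 0 through its factor k, and at k = n + 2 through the factor j = n
   + 1 of W, which contains j - (n + 1). *)
rewrite sumrN telescope_sumr // /w mulr0 mul0r subr0.
by rewrite /W big_ord_recr /= [wz_factor A s r n n.+1]/wz_factor subrr !(mulr0, mul0r) oppr0 mulr0.
Qed.
End Dougall.

Lemma fact_neq0 m : m`!%:R != 0 :> rat.
Proof. by rewrite pnatr_eq0 -lt0n fact_gt0. Qed.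

(** * Dougall's sum with cubic factors *)

Section CubicDougall.
Implicit Types (A t : rat) (n k j : nat).

(* Choosing s = - 2 n - 3 t and r = n^2 + 3 n t + 3 t^2 merges the parameters
   b, c, - n of the 5F4 sum into the factors of (A + j)^3 + t^3. *)
Definition cubic_s t n : rat := - (2%:R * n%:R) - 3%:R * t.
Definition cubic_r t n : rat := n%:R ^+ 2 + 3%:R * n%:R * t + 3%:R * t ^+ 2.

Definition cubic_norm t j : rat := j%:R ^+ 2 + j%:R * t + t ^+ 2.

Definition cubic_factor A t j : rat :=
  (A + j%:R) * ((A + j%:R) ^+ 3 + t ^+ 3) / (j.+1%:R * (j.+1%:R ^+ 3 - t ^+ 3)).

Lemma cubic_norm_neq0 t j : cubic_norm t j.+1 != 0.
Proof.
have h : 0 < j.+1%:R :> rat by rewrite ltr0n.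
rewrite gt_eqF // /cubic_norm; move: (j.+1%:R) h => x h.
have := sqr_ge0 (x + 2%:R * t); have : 0 < x * x by rewrite mulr_gt0.
by rewrite !expr2; nra.
Qed.

Variables (A t : rat) (n : nat).
Hypothesis A_def : A = - t - n%:R.
Hypothesis A_neq0 : forall j, A + j%:R != 0.

Lemma wp_cubic j : wp_poly (cubic_s t n) (cubic_r t n) (A + j%:R) = cubic_norm t j.
Proof. by rewrite /wp_poly /cubic_s /cubic_r /cubic_norm A_def; ring. Qed.

(** Because A + t = - n, the cube sum (A + j)^3 + t^3 is divisible by A + j + t = j - n; and y^3 -
    t^3 with y = j + 1 is (y - t) times [cubic_norm], where y - t = A + y + n. *)
Lemma cubic_dougall_factor j :
  dougall_factor A (cubic_s t n) (cubic_r t n) n j = cubic_factor A t j.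
Proof.
rewrite /dougall_factor /cubic_factor wp_cubic.
have h := cubic_norm_neq0 t j; have h2 := A_neq0 (j.+1 + n).
have h3 : j.+1%:R != 0 :> rat by rewrite pnatr_eq0.
have -> : (j.+1%:R ^+ 3 - t ^+ 3) = cubic_norm t j.+1 * (A + j.+1%:R + n%:R).
  by rewrite A_def /cubic_norm; ring.
rewrite -[_ * cubic_norm _ _ * _]mulrA; congr (_ / _).
by rewrite A_def /cubic_s /cubic_r; ring.
Qed.

Lemma cubic_dougall :
  \sum_(k < n.+1) (A + 2%:R * k%:R) * \prod_(j < k) cubic_factor A t j
  = A * \prod_(j < n) ((A + j.+1%:R) * (j.+1%:R + n%:R + 2%:R * t)
                       / cubic_norm t j.+1).
Proof.
transitivity (\sum_(k < n.+1) dougall_term A (cubic_s t n) (cubic_r t n) n k).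
  apply: eq_bigr => k _; congr (_ * _); apply: eq_bigr => j _.
  by rewrite cubic_dougall_factor.
rewrite dougall_sum //; last by move=> j; rewrite wp_cubic cubic_norm_neq0.
congr (_ * _); apply: eq_bigr => j _; rewrite wp_cubic; congr (_ * _ / _).
by rewrite /cubic_s A_def; ring.
Qed.

Hypothesis A_val : 4%:R * A = 3%:R.

(** Here 2 A = 3/2, and the rising factorial of 3/2 is (2 m + 1)! / (4^m m!). This is the source of
    the central binomial coefficient. *)
Lemma prod_three_halves m :
  \prod_(j < m) (2%:R * A + j%:R)
  = m.*2.+1%:R * 'C(m.*2, m)%:R * m`!%:R / 4%:R ^+ m.
Proof.
have -> : m.*2.+1%:R * 'C(m.*2, m)%:R * m`!%:R = (m.*2.+1)`!%:R / m`!%:R :> rat.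
  have := @bin_fact m.*2 m; rewrite -addnn leq_addl addnK addnn => /(_ isT) e.
  by rewrite factS -e !natrM !mulrA mulfK ?fact_neq0.
elim: m => [|m IHm]; first by rewrite big_ord0 divr1.
rewrite big_ord_recr /= {}IHm doubleS !factS !natrM exprS.
move: (fact_neq0 m); have -> : 2%:R * A = 3%:R / 2%:R by move: A_val; lra.
rewrite -!natr1 -addnn natrD; move: (_`!%:R) (m`!%:R) => u v v0.
have h : m%:R + 1 != 0 :> rat by rewrite natr1 pnatr_eq0.
have h4 : (4%:R ^+ m != 0 :> rat) by rewrite expf_neq0.
by field; repeat (apply/andP; split).
Qed.

(** Reversing the products turns A + j into - (t + j') and j + 1 + n + 2 t into - (2 A + j'). What
    is left over (j + 1) (j + 1 + t) = [cubic_norm] - t^2 gives the factors 1 - t^2 /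
    [cubic_norm]. *)
Lemma cubic_dougall_value :
  4%:R * (A * \prod_(j < n) ((A + j.+1%:R) * (j.+1%:R + n%:R + 2%:R * t)
                       / cubic_norm t j.+1))
  = - (4%:R * t) * (n.*2.+1%:R * 'C(n.*2, n)%:R / 4%:R ^+ n)
    * \prod_(j < n) (1 - t ^+ 2 / cubic_norm t j.+1).
Proof.
have e1 : A * \prod_(j < n) (A + j.+1%:R)
          = (-1) ^+ n.+1 * (t * \prod_(j < n) (t + j.+1%:R)).
  transitivity (\prod_(j < n.+1) (A + j%:R)).
    by rewrite big_ord_recl addr0.
  rewrite (reindex_inj rev_ord_inj) /= (eq_bigr (fun j : 'I_n.+1 => - (t + j%:R))).
    by rewrite prodrN card_ord big_ord_recl addr0.
  by move=> j _; rewrite subSS natrB ?A_def; [ring | rewrite -ltnS].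
have e2 : \prod_(j < n) (j.+1%:R + n%:R + 2%:R * t)
          = (-1) ^+ n * \prod_(j < n) (2%:R * A + j%:R).
  rewrite (reindex_inj rev_ord_inj) /= (eq_bigr (fun j : 'I_n => - (2%:R * A + j%:R))).
    by rewrite prodrN card_ord.
  by move=> j _; rewrite -natr1 natrB ?ltn_ord // -natr1 A_def; ring.
have e3 : \prod_(j < n) (1 - t ^+ 2 / cubic_norm t j.+1)
    = n`!%:R * \prod_(j < n) (t + j.+1%:R) * (\prod_(j < n) cubic_norm t j.+1)^-1.
  have -> : n`!%:R = \prod_(j < n) j.+1%:R :> rat.
    elim: (n) => [|k IHk]; first by rewrite big_ord0.
    by rewrite big_ord_recr /= -IHk factS mulrC natrM.
  rewrite -prodfV -!big_split /=; apply: eq_bigr => j _.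
  have := cubic_norm_neq0 t j; set N := cubic_norm _ _ => N0.
  have -> : 1 - t ^+ 2 / N = (N - t ^+ 2) / N by rewrite mulrBl divff.
  by congr (_ / _); rewrite /N /cubic_norm; ring.
rewrite big_split prodfV big_split /= [A * _]mulrA [A * (_ * _)]mulrA e1 e2 e3 prod_three_halves.
rewrite exprS; move: (signr_odd rat n); case: odd => <- /=; rewrite ?expr0 ?expr1; ring.
Qed.

End CubicDougall.

(** * The sum modulo p^4 *)

Section CoreCongruence.
Variable p : nat.
Hypothesis p_prime : prime p.
Implicit Types (a b c x : rat) (j k m : nat).

Local Notation P := (p%:R : rat).
Local Notation Zp := (Zloc p).

Lemma prime_coprime_small m : (0 < m < p)%N -> coprime p m.
Proof.
case/andP=> m_gt0 lt_mp; rewrite prime_coprime //.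
by apply/negP => /dvdn_leq; rewrite m_gt0 leqNgt lt_mp => /(_ isT).
Qed.

Lemma Zloc_small_natV m : (0 < m < p)%N -> m%:R^-1 \in Zp.
Proof. by move/prime_coprime_small/Zloc_natV. Qed.

Lemma eqloc_zero k a : a \in Zp -> eqloc p k (P ^+ k * a) 0.
Proof. by move=> Za; apply/(eqlocP p_prime); exists a; rewrite ?add0r. Qed.

Lemma eqloc_Dzero k a b : eqloc p k b 0 -> eqloc p k (a + b) a.
Proof. by move=> h; rewrite -[X in eqloc _ _ _ X]addr0 eqlocD ?eqloc_refl. Qed.

Lemma one_unit a : eqloc p 1 a 1 -> a != 0 /\ a^-1 \in Zp.
Proof. by move=> h; apply: (eqloc1_unit p_prime) h _; rewrite ?invr1 ?rpred1. Qed.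

Definition harm3 m : rat := \sum_(j < m) j.+1%:R ^- 3.

Lemma harm3_rev n k : (k <= n)%N ->
  \sum_(j < k) (n%:R - j%:R) ^- 3 = harm3 n - harm3 (n - k).
Proof.
elim: k => [|k IHk] le_kn; first by rewrite big_ord0 subn0 subrr.
rewrite big_ord_recr /= IHk 1?ltnW // -[(n - k)%N]prednK ?subn_gt0 //.
rewrite {2}/harm3 big_ord_recr /= -/(harm3 _) prednK ?subn_gt0 // -subnS.
by rewrite -natrB 1?ltnW //; ring.
Qed.

Lemma sum_binomial4_antisymmetric n :
  \sum_(k < n.+1) (2%:R * k%:R - n%:R) * 'C(n, k)%:R ^+ 4
    * (harm3 k + harm3 (n - k) - harm3 n) = 0 :> rat.
Proof.
set S := LHS; suff : S = - S by lra.
rewrite {2}/S -sumrN /S (reindex_inj rev_ord_inj) /=; apply: eq_bigr => k _.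
have le_kn : (k <= n)%N by rewrite -ltnS.
rewrite subSS subKn // bin_sub // natrB //; ring.
Qed.

Lemma bin_prod_frac n k : (k <= n)%N ->
  'C(n, k)%:R = \prod_(j < k) ((n%:R - j%:R) / j.+1%:R) :> rat.
Proof.
elim: k => [|k IHk] le_kn; first by rewrite big_ord0 bin0.
rewrite big_ord_recr /= -IHk 1?ltnW // -natrB 1?ltnW // mulrA.
apply: canRL (mulfK _) _; first by rewrite pnatr_eq0.
by rewrite -!natrM mulnC mul_bin_left mulnC.
Qed.

Variables (A t : rat) (n e : nat).
Hypothesis p_gt3 : (3 < p)%N.
Hypothesis n_e : (4 * n + 3 = p * e)%N.
Hypothesis lt_np : (n < p)%N.
Hypothesis A_val : 4%:R * A = 3%:R.
Hypothesis t_def : t = - A - n%:R.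

Let A_E : A = - t - n%:R. Proof. by rewrite t_def; ring. Qed.

Let A_gt0 : 0 < A. Proof. by move: A_val; lra. Qed.

Let A_neq0 j : A + j%:R != 0.
Proof. by rewrite gt_eqF // ltr_wpDr ?ler0n. Qed.

Let Z4V : 4%:R^-1 \in Zp.
Proof.
apply: Zloc_natV; rewrite (@coprimeXr 2 p 2) // coprime_sym coprime2n.
by have [p2|//] := even_prime p_prime; move: p_gt3; rewrite p2.
Qed.

Let ZA : A \in Zp.
Proof. by rewrite -[A](mulKf (_ : 4%:R != 0)) // A_val rpredM ?rpred_nat. Qed.

Let t_P : t = P * (- (e%:R / 4%:R)).
Proof.
have := congr1 (fun m => m%:R : rat) n_e.
rewrite natrD !natrM t_def => h; have -> : A = 3%:R / 4%:R by move: A_val; lra.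
by rewrite mulrN mulrA -h; field.
Qed.

Let Zt' : - (e%:R / 4%:R) \in Zp.
Proof. by rewrite rpredN rpredM ?rpred_nat. Qed.

Let Zt : t \in Zp. Proof. by rewrite t_P rpredM ?rpred_nat. Qed.

Let cube_P : t ^+ 3 = P ^+ 3 * (- (e%:R / 4%:R)) ^+ 3.
Proof. by rewrite t_P exprMn. Qed.

Let Aj_unit j : (j < n)%N -> (A + j%:R)^-1 \in Zp.
Proof.
move=> lt_jn; have h : (0 < n - j < p)%N by rewrite subn_gt0 lt_jn (leq_ltn_trans _ lt_np) ?leq_subr.
have [] := @eqloc1_unit _ p_prime (- (A + j%:R)) ((n - j)%N%:R).
- by rewrite pnatr_eq0 subn_eq0 -ltnNge.
- exact: Zloc_small_natV.
- apply/(eqlocP p_prime); exists (- (e%:R / 4%:R)) => //.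
  by rewrite expr1 -t_P natrB 1?ltnW // A_E; ring.
- exact: rpred_nat.
by move=> _; rewrite invrN rpredN.
Qed.

Let j1_unit j : (j < n)%N -> j.+1%:R^-1 \in Zp.
Proof. by move=> h; apply: Zloc_small_natV; rewrite /= (leq_ltn_trans h). Qed.

Let R k := \prod_(j < k) ((A + j%:R) / j.+1%:R).
Let c k := \sum_(j < k) ((A + j%:R) ^- 3 + j.+1%:R ^- 3).

Let ZR k : (k <= n)%N -> R k \in Zp.
Proof.
move=> le_kn; rewrite rpred_prod // => j _.
by rewrite rpredM ?rpredD ?rpred_nat ?j1_unit // (leq_trans _ le_kn).
Qed.

Let Zc k : (k <= n)%N -> c k \in Zp.
Proof.
move=> le_kn; rewrite rpred_sum // => j _.
by rewrite -!exprVn rpredD ?rpredX ?j1_unit ?Aj_unit // (leq_trans _ le_kn).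
Qed.

Let gbinom_R k : gbinom (- A) k ^+ 4 = R k ^+ 4.
Proof.
suff -> : gbinom (- A) k = (-1) ^+ k * R k.
  by rewrite exprMn -exprM mulnC exprM -signr_odd expr1n mul1r.
rewrite /gbinom; elim: k => [|k IHk]; first by rewrite /R !big_ord0 fact0 invr1.
rewrite big_ord_recr /= factS natrM invfM.
rewrite /R big_ord_recr /= -/(R k) exprS.
have -> : (-1) * (-1) ^+ k * (R k * ((A + k%:R) / k.+1%:R))
   = ((-1) ^+ k * R k) * ((- A - k%:R) / k.+1%:R) :> rat by ring.
by rewrite -IHk; ring.
Qed.

(** The factor i = n of the numerator is - A - n = t, a multiple of p, whereas k! is prime to p. *)
Let tail_zero k : (n < k < p)%N -> eqloc p 4 (gbinom (- A) k ^+ 4) 0.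
Proof.
case/andP=> lt_nk lt_kp.
have [b Zb ->] : exists2 b, b \in Zp & gbinom (- A) k = P * b.
  exists ((- (e%:R / 4%:R)) * \prod_(i < k | i != Ordinal lt_nk) (- A - i%:R) / k`!%:R).
    rewrite !rpredM ?rpred_prod // => [i _|]; first by rewrite rpredB ?rpredN ?rpred_nat.
    apply: Zloc_natV; rewrite coprime_sym; elim: k lt_kp {lt_nk} => [|k IHk] h.
      by rewrite coprime1n.
    by rewrite factS coprimeMl IHk 1?ltnW // andbT coprime_sym prime_coprime_small.
  rewrite /gbinom (bigD1 (Ordinal lt_nk)) //= -t_def t_P; ring.
by rewrite exprMn eqloc_zero ?rpredX.
Qed.

(* As p divides t, replacing (A + j)^3 + t^3 by (A + j)^3 and (j + 1)^3 - t^3 by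
   (j + 1)^3 costs a relative error of order t^3, whose coefficient in the sum
   vanishes modulo p by the antisymmetry k -> n - k. *)
Let factor_expand j : (j < n)%N ->
  eqloc p 4 (cubic_factor A t j)
    (((A + j%:R) / j.+1%:R) ^+ 4 * (1 + t ^+ 3 * ((A + j%:R) ^- 3 + j.+1%:R ^- 3))).
Proof.
move=> lt_jn; have ZX := Aj_unit lt_jn; have ZY := j1_unit lt_jn.
have X0 := A_neq0 j; have Y0 : j.+1%:R != 0 :> rat by rewrite pnatr_eq0.
have ZX' : A + j%:R \in Zp by rewrite rpredD ?rpred_nat.
move: cube_P Zt'; set z := - _ => cubeP Zz.
rewrite /cubic_factor; move: (A + j%:R) (j.+1%:R) ZX ZY X0 Y0 ZX' => X Y ZX ZY X0 Y0 ZX'.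
have [d0 Zd] : 1 - t ^+ 3 * Y ^- 3 != 0 /\ (1 - t ^+ 3 * Y ^- 3)^-1 \in Zp.
  apply: one_unit; apply: eqloc_Dzero.
  have -> : - (t ^+ 3 * Y ^- 3) = P ^+ 1 * - (P ^+ 2 * z ^+ 3 * Y^-1 ^+ 3).
    by rewrite cubeP exprVn; ring.
  by rewrite eqloc_zero // rpredN !rpredM ?rpredX ?rpred_nat.
have D0 : Y ^+ 3 - t ^+ 3 != 0.
  have -> : Y ^+ 3 - t ^+ 3 = Y ^+ 3 * (1 - t ^+ 3 * Y ^- 3) by field.
  by rewrite mulf_neq0 ?expf_neq0.
apply/(eqlocP p_prime).
(* With a = t^3 / X^3 and b = t^3 / Y^3, the quotient (1 + a) / (1 - b) exceeds 1 + a + b by b (a +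
   b) / (1 - b), which has the factor t^6. *)
exists (P ^+ 2 * (z ^+ 6 * (X * Y^-1) ^+ 4 * Y^-1 ^+ 3 * (X^-1 ^+ 3 + Y^-1 ^+ 3)
        * (1 - t ^+ 3 * Y ^- 3)^-1)).
  by zloc.
transitivity (((X / Y) ^+ 4 * (1 + t ^+ 3 * (X ^- 3 + Y ^- 3)))
  + (t ^+ 3) ^+ 2 * ((X * Y^-1) ^+ 4 * Y^-1 ^+ 3 * (X^-1 ^+ 3 + Y^-1 ^+ 3)
        * (1 - t ^+ 3 * Y ^- 3)^-1)); last first.
  by congr (_ + _); rewrite {1}cubeP; ring.
by field; rewrite Y0 D0 X0.
Qed.

Let prod_expand k : (k <= n)%N ->
  eqloc p 4 (\prod_(j < k) cubic_factor A t j) (R k ^+ 4 * (1 + t ^+ 3 * c k)).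
Proof.
elim: k => [|k IHk] lt_kn.
  by rewrite /R /c !big_ord0 mulr0 addr0 expr1n mulr1 eqloc_refl.
have IH := IHk (ltnW lt_kn); have H := factor_expand lt_kn.
have ZX := Aj_unit lt_kn; have ZY := j1_unit lt_kn.
have ZRk := ZR (ltnW lt_kn); have Zck := Zc (ltnW lt_kn).
rewrite big_ord_recr /=; apply: eqloc_trans (eqlocM _ _ IH H) _.
- by zloc.
- rewrite /cubic_factor; apply: eqloc_Zloc H _ => //.
  rewrite -!exprVn; by zloc.
rewrite /R /c !big_ord_recr /= -/(R k) -/(c k).
move: (R k) (c k) cube_P Zt' ZRk Zck ZX ZY; set z := - (_ / _) => r d cubeP Zz Zr Zd.
have ZX' : A + k%:R \in Zp by rewrite rpredD ?rpred_nat.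
move: (A + _) (_.+1%:R) ZX' => X Y ZX' ZX ZY.
apply/(eqlocP p_prime); exists (P ^+ 2 * (z ^+ 6 * (r * (X * Y^-1)) ^+ 4 * d * (X^-1 ^+ 3 + Y^-1 ^+ 3))).
  by zloc.
transitivity ((r * (X / Y)) ^+ 4 * (1 + t ^+ 3 * (d + (X ^- 3 + Y ^- 3)))
   + (t ^+ 3) ^+ 2 * ((r * (X * Y^-1)) ^+ 4 * d * (X^-1 ^+ 3 + Y^-1 ^+ 3))); last first.
  by congr (_ + _); rewrite cubeP; ring.
by rewrite !exprVn; ring.
Qed.

(** As t vanishes modulo p, A + j reduces to j - n. Thus [R k] reduces to C(n, k) up to sign, and
    [c k] to the combination in [sum_binomial4_antisymmetric]. *)
Let eqloc_Aj j : eqloc p 1 (A + j%:R) (- (n%:R - j%:R)).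
Proof.
apply/(eqlocP p_prime); exists (e%:R / 4%:R); first by rewrite -rpredN.
by rewrite A_E t_P expr1; ring.
Qed.

Let nj_unit j : (j < n)%N -> n%:R - j%:R != 0 :> rat /\ (n%:R - j%:R)^-1 \in Zp.
Proof.
move=> lt_jn; rewrite -natrB 1?ltnW //; split.
  by rewrite pnatr_eq0 subn_eq0 -ltnNge.
by apply: Zloc_small_natV; rewrite subn_gt0 lt_jn (leq_ltn_trans _ lt_np) ?leq_subr.
Qed.

Let R_mod k : (k <= n)%N -> eqloc p 1 (R k ^+ 4) ('C(n, k)%:R ^+ 4).
Proof.
move=> le_kn; have -> : 'C(n, k)%:R ^+ 4 = (\prod_(j < k) (- (n%:R - j%:R) / j.+1%:R)) ^+ 4 :> rat.
  rewrite bin_prod_frac //; under [in RHS]eq_bigr do rewrite mulNr.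
  by rewrite prodrN exprMn -exprM mulnC exprM -signr_odd expr1n mul1r.
apply: eqlocX => //; first exact: ZR.
  apply: rpred_prod => j _; rewrite rpredM ?rpredN ?rpredB ?rpred_nat //.
  by rewrite j1_unit // (leq_trans _ le_kn).
apply: eqloc_prod => // j _; have lt_jn : (j < n)%N by apply: leq_trans le_kn.
by split; rewrite ?rpredM ?rpredN ?rpredB ?rpredD ?rpred_nat ?j1_unit ?eqlocMr ?j1_unit.
Qed.

Let c_mod k : (k <= n)%N -> eqloc p 1 (c k) (harm3 k + harm3 (n - k) - harm3 n).
Proof.
move=> le_kn; have -> : harm3 k + harm3 (n - k) - harm3 n
   = \sum_(j < k) ((- (n%:R - j%:R)) ^- 3 + j.+1%:R ^- 3).
  rewrite big_split /= -/(harm3 k).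
  under eq_bigr do rewrite -exprVn invrN exprNn exprVn -signr_odd expr1 mulN1r.
  by rewrite sumrN harm3_rev //; ring.
apply: eqloc_sum => j _; have lt_jn : (j < n)%N by apply: leq_trans le_kn.
have [nj0 Znj] := nj_unit lt_jn.
apply: eqlocD; last exact: eqloc_refl.
rewrite -!exprVn; apply: eqlocX; rewrite ?invrN ?rpredN ?Aj_unit // -invrN.
by apply: eqlocV; rewrite ?oppr_eq0 ?invrN ?rpredN ?Aj_unit.
Qed.

Let correction_zero :
  eqloc p 4 (\sum_(k < n.+1) (A + 2%:R * k%:R) * (R k ^+ 4 * (t ^+ 3 * c k))) 0.
Proof.
have -> : \sum_(k < n.+1) (A + 2%:R * k%:R) * (R k ^+ 4 * (t ^+ 3 * c k))
   = P ^+ 3 * ((- (e%:R / 4%:R)) ^+ 3 * \sum_(k < n.+1) (A + 2%:R * k%:R) * R k ^+ 4 * c k).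
  by rewrite mulrA -cube_P mulr_sumr; apply: eq_bigr => k _; ring.
rewrite -[X in eqloc _ _ _ X](mulr0 (P ^+ 3)); apply: (@eqloc_mulP p p_prime 3 1).
rewrite -[X in eqloc _ _ _ X](mulr0 ((- (e%:R / 4%:R)) ^+ 3)); apply: eqlocMl.
  exact: rpredX.
rewrite -[X in eqloc _ _ _ X](sum_binomial4_antisymmetric n); apply: eqloc_sum => k _.
have le_kn : (k <= n)%N by rewrite -ltnS.
apply: eqlocM => //.
- by rewrite rpredM ?rpredX ?rpredB ?rpredM ?rpred_nat.
- exact: Zc.
- apply: eqlocM => //; last exact: R_mod.
  + by rewrite rpredB ?rpredM ?rpred_nat.
  + by rewrite rpredX ?ZR.
  apply/(eqlocP p_prime); exists (e%:R / 4%:R); first by rewrite -rpredN.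
  by rewrite A_E t_P expr1; ring.
exact: c_mod.
Qed.

Theorem core_congruence :
  eqloc p 4 (\sum_(0 <= k < p) (8 * k + 3)%:R * gbinom (- A) k ^+ 4)
    (p%:R * e%:R * (n.*2.+1%:R * 'C(n.*2, n)%:R / 4%:R ^+ n)
     * \prod_(j < n) (1 - t ^+ 2 / cubic_norm t j.+1)).
Proof.
have -> : p%:R * e%:R = - (4%:R * t) by rewrite t_P; field.
rewrite -(cubic_dougall_value A_E A_val) -(cubic_dougall A_E A_neq0).
rewrite (@big_cat_nat _ _ _ n.+1) //=.
have tail : eqloc p 4 (\sum_(n.+1 <= k < p) (8 * k + 3)%:R * gbinom (- A) k ^+ 4) 0.
  rewrite big_seq; apply: (big_ind (fun x => eqloc p 4 x 0)) => [|x y x0 y0|k].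
  - exact: eqloc_refl.
  - by rewrite -[0]addr0 eqlocD.
  rewrite mem_index_iota => h.
  by rewrite -[X in eqloc _ _ _ X](mulr0 (8 * k + 3)%:R) eqlocMl ?rpred_nat ?tail_zero.
apply: eqloc_trans (eqloc_Dzero _ tail) _.
rewrite big_mkord mulr_sumr.
apply: (@eqloc_trans _ _ (\sum_(k < n.+1) 4%:R * ((A + 2%:R * k%:R) * (R k ^+ 4 * (1 + t ^+ 3 * c k))))).
  apply: eqloc_sym.
  have -> : \sum_(k < n.+1) 4%:R * ((A + 2%:R * k%:R) * (R k ^+ 4 * (1 + t ^+ 3 * c k)))
     = \sum_(k < n.+1) (8 * k + 3)%:R * gbinom (- A) k ^+ 4
       + 4%:R * \sum_(k < n.+1) (A + 2%:R * k%:R) * (R k ^+ 4 * (t ^+ 3 * c k)).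
    rewrite mulr_sumr -big_split /=; apply: eq_bigr => k _.
    by rewrite gbinom_R natrD natrM -A_val; ring.
  apply: eqloc_Dzero; rewrite -[X in eqloc _ _ _ X](mulr0 4%:R).
  by rewrite eqlocMl ?rpred_nat ?correction_zero.
apply: eqloc_sum => k _; apply: eqlocMl; first exact: rpred_nat.
apply: eqlocMl; first by rewrite rpredD ?rpredM ?rpred_nat.
by apply: eqloc_sym; apply: prod_expand; rewrite -ltnS.
Qed.

End CoreCongruence.

(** * Powers of 2 and harmonic numbers *)

Section PowersOfTwo.
Implicit Types (h i k m N : nat).

Lemma odd_neq0 i : i.*2.+1%:R != 0 :> rat.
Proof. by rewrite pnatr_eq0. Qed.

Lemma one_plus_div (x y : rat) : y != 0 -> 1 + x / y = (y + x) / y.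
Proof. by move=> y0; rewrite mulrDl divff. Qed.

Lemma prod_odd k :
  \prod_(i < k) i.*2.+1%:R = (k.*2)`!%:R / (2%:R ^+ k * k`!%:R) :> rat.
Proof.
elim: k => [|k IHk]; first by rewrite big_ord0 divr1.
rewrite big_ord_recr /= IHk doubleS !factS !natrM exprS.
have := fact_neq0 k; have : 2%:R ^+ k != 0 :> rat by rewrite expf_neq0.
have : k.+1%:R != 0 :> rat by rewrite pnatr_eq0.
have -> : k.*2.+2%:R = 2%:R * k.+1%:R :> rat by rewrite -natrM mul2n.
move: (k.+1%:R) (_ ^+ k) (k`!%:R) => x y z x0 y0 z0.
by field; rewrite x0 y0 z0.
Qed.

Lemma prod_double_down N k : (k <= N)%N ->
  \prod_(i < k) (2%:R * (N%:R - i%:R)) = 2%:R ^+ k * N`!%:R / (N - k)`!%:R :> rat.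
Proof.
elim: k => [|k IHk] lt_kN; first by rewrite big_ord0 subn0 mul1r divff ?fact_neq0.
rewrite big_ord_recr /= IHk 1?ltnW // exprS -natrB 1?ltnW //.
have := subnSK lt_kN => <-; rewrite factS natrM.
have := fact_neq0 (N - k.+1); move: (_`!%:R : rat) => z z0.
have x0 : (N - k.+1).+1%:R != 0 :> rat by rewrite pnatr_eq0.
by move: (_.+1%:R) x0 => x x0; field; rewrite x0 z0.
Qed.

(* Gauss's lemma as an identity: among 2, 4, ..., 2 N those beyond N are
   (2 N + 1) - (2 i + 1) for i < k. *)
Lemma exp2_sum_prod h k : (k == h) || (k == h.+1) ->
  2%:R ^+ (h + k) =
  (-1) ^+ k * \prod_(i < k) (1 - (h + k).*2.+1%:R / i.*2.+1%:R) :> rat.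
Proof.
move=> hk; set N := (h + k)%N.
have -> : \prod_(i < k) (1 - N.*2.+1%:R / i.*2.+1%:R)
    = (-1) ^+ k * \prod_(i < k) (2%:R * (N%:R - i%:R)) / \prod_(i < k) i.*2.+1%:R :> rat.
  rewrite -[k in (-1) ^+ k]card_ord -prodrN -prodfV -big_split /=; apply: eq_bigr => i _.
  rewrite -[- _]mulNr one_plus_div ?odd_neq0 //; congr (_ / _); rewrite -!natr1 -!muln2 !natrM; ring.
rewrite !mulrA -expr2 sqrr_sign mul1r prod_double_down ?leq_addl // addnK prod_odd.
have z0 := fact_neq0; have y0 m : 2%:R ^+ m != 0 :> rat by rewrite expf_neq0.
case/orP: hk => /eqP hk; rewrite /N hk.
  rewrite addnn -addnn exprD; move: (z0 h) (z0 (h + h)%N) (y0 h).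
  move: (_`!%:R) (_`!%:R) (_ ^+ _) => a b c a0 b0 c0.
  by field; rewrite a0 b0 c0.
rewrite addnS addnn doubleS !factS !natrM !exprS -addnn exprD.
have e2 : (h + h).+2%:R = 2%:R * (h%:R + 1) :> rat.
  by rewrite natr1 -natrM mul2n doubleS -addnn.
have : h%:R + 1 != 0 :> rat by rewrite natr1 pnatr_eq0.
have : (h + h).+1%:R != 0 :> rat by rewrite pnatr_eq0.
rewrite e2 -[h.+1%:R]natr1; move: (z0 h) (z0 (h + h)%N) (y0 h).
move: (h`!%:R) ((h + h)`!%:R) (2%:R ^+ h) (h%:R) ((h + h).+1%:R) => a b c d f a0 b0 c0 f0 d0.
by field; rewrite a0 b0 c0 d0 f0.
Qed.

(** The numerators (2 N + 1) + (2 i + 1) are 2 (N + 1), ..., 2 (2 N). For 2 N + 1 = p this expresses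
    2^(p-1) independently of [exp2_sum_prod]; [exp2_1mod4] plays the two against each other. *)
Lemma exp2_double_prod N :
  2%:R ^+ N.*2 = \prod_(i < N) (1 + N.*2.+1%:R / i.*2.+1%:R) :> rat.
Proof.
have -> : \prod_(i < N) (1 + N.*2.+1%:R / i.*2.+1%:R)
    = \prod_(i < N) (2%:R * (N.*2%:R - i%:R)) / \prod_(i < N) i.*2.+1%:R :> rat.
  rewrite [in RHS](reindex_inj rev_ord_inj) -prodfV -big_split /=; apply: eq_bigr => i _.
  rewrite one_plus_div ?odd_neq0 //; congr (_ / _); rewrite natrB ?ltn_ord // -!natr1 -!muln2 !natrM; ring.
rewrite prod_double_down -?addnn ?leq_addl // addnK prod_odd addnn.
have := fact_neq0 N.*2; have := fact_neq0 N.
have : 2%:R ^+ N != 0 :> rat by rewrite expf_neq0.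
rewrite -addnn exprD addnn.
move: (_`!%:R) (_`!%:R) (_ ^+ _) => a b c c0 a0 b0.
by field; rewrite a0 b0 c0.
Qed.

Definition harm m : rat := \sum_(j < m) j.+1%:R^-1.
Definition odd_harm k : rat := \sum_(i < k) i.*2.+1%:R^-1.

Lemma odd_harmE k : odd_harm k = harm k.*2 - harm k / 2%:R.
Proof.
rewrite /odd_harm /harm; elim: k => [|k IHk]; first by rewrite !big_ord0 mul0r subr0.
rewrite doubleS !big_ord_recr /= IHk.
have -> : k.*2.+2%:R = 2%:R * k.+1%:R :> rat by rewrite -natrM mul2n.
by rewrite invfM; ring.
Qed.

Section Mod.
Variable p : nat.
Hypothesis p_prime : prime p.
Local Notation P := (p%:R : rat).

Lemma prod_one_plus_pow l (I : eqType) (r : seq I) (a : I -> rat) :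
  (forall i : I, i \in r -> a i \in Zloc p) ->
  eqloc p (l + l) (\prod_(i <- r) (1 + P ^+ l * a i)) (1 + P ^+ l * \sum_(i <- r) a i).
Proof.
elim: r => [|i r IHr] Za; first by rewrite !big_nil mulr0 addr0 eqloc_refl.
have Zi := Za i (mem_head _ _).
have Zr j : j \in r -> a j \in Zloc p by move=> jr; rewrite Za ?inE ?jr ?orbT.
have Zs : \sum_(i <- r) a i \in Zloc p by rewrite big_seq rpred_sum.
rewrite !big_cons; apply: eqloc_trans (eqlocMl _ (IHr Zr)) _; first by zloc.
apply/(eqlocP p_prime); exists (a i * \sum_(j <- r) a j); first by zloc.
by rewrite exprD; ring.
Qed.

Lemma prod_one_plus (I : eqType) (r : seq I) (a : I -> rat) :
  (forall i : I, i \in r -> a i \in Zloc p) ->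
  eqloc p 2 (\prod_(i <- r) (1 + P * a i)) (1 + P * \sum_(i <- r) a i).
Proof. exact: (@prod_one_plus_pow 1). Qed.

Lemma eqloc_prod_one (I : eqType) (r : seq I) (a : I -> rat) :
  (forall i : I, i \in r -> a i \in Zloc p) ->
  eqloc p 1 (\prod_(i <- r) (1 + P * a i)) 1.
Proof.
move=> Za; apply: eqloc_trans (@eqloc_weak _ p_prime 1 2 _ _ isT (prod_one_plus Za)) _.
apply/(eqlocP p_prime); exists (\sum_(i <- r) a i) => //.
by rewrite big_seq rpred_sum.
Qed.

Lemma eqloc_modn_pow k a b : a = b %[mod p ^ k] -> eqloc p k a%:R b%:R.
Proof.
move=> e; apply/(eqlocP p_prime); exists ((a %/ p ^ k)%N%:R - (b %/ p ^ k)%N%:R).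
  by rewrite rpredB ?rpred_nat.
by rewrite -natrX {1}(divn_eq a (p ^ k)) {1}(divn_eq b (p ^ k)) e !natrD !natrM; ring.
Qed.

Lemma eqloc_modn a b : a = b %[mod p] -> eqloc p 1 a%:R b%:R.
Proof. by rewrite -{1 2}(expn1 p); apply: eqloc_modn_pow. Qed.

Lemma eqloc_fermat a : coprime p a -> eqloc p 1 (a%:R ^+ p.-1) 1.
Proof.
move=> co; rewrite -natrX; apply: (@eqloc_modn _ 1).
by rewrite -(totient_prime p_prime) Euler_exp_totient 1?coprime_sym.
Qed.

End Mod.
End PowersOfTwo.

(** * Euler numbers *)

Section EulerFunctional.
Implicit Types (m i j k N : nat) (x y : rat) (f g : {poly rat}).

(** The linear functional sending X^i to E_i, truncated at degree N so that sums for different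
    polynomials share one range. *)
Definition euler_umbra N f : rat := \sum_(i < N) f`_i * (euler i)%:~R.

Lemma coef_XaddC_exp y j i :
  (('X + y%:P) ^+ j)`_i = 'C(j, i)%:R * y ^+ (j - i) :> rat.
Proof.
rewrite addrC exprDn coef_sum.
under eq_bigr => k _ do rewrite coefMn -rmorphXn /= coefCM coefXn.
case: (ltnP i j.+1) => [lt_ij|le_ji].
  rewrite (bigD1 (Ordinal lt_ij)) //= big1 ?addr0 => [|k /negbTE ne_ki].
    by rewrite eqxx mulr1 mulr_natl.
  by rewrite eq_sym -[(nat_of_ord k == i)]/(k == Ordinal lt_ij) ne_ki mulr0 mul0rn.
rewrite bin_small // mul0r big1 // => k _.
by rewrite gtn_eqF ?mulr0 ?mul0rn // (leq_trans (ltn_ord k)).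
Qed.

(** Umbrally, (E + 1)^m + (E - 1)^m = 0. For odd m every term vanishes; for even m the odd indices
    drop out and twice the defining recurrence remains. *)
Lemma sum_euler_binomial m : (0 < m)%N ->
  \sum_(i < m.+1) ('C(m, i)%:R * (1 ^+ (m - i) + (-1) ^+ (m - i)) * (euler i)%:~R) = 0 :> rat.
Proof.
move=> m_gt0; case: (boolP (odd m)) => [odd_m|even_m].
  apply: big1 => i _; case: (boolP (odd i)) => odd_i.
    by rewrite /euler odd_i mulr0.
  by rewrite expr1n -signr_odd oddB -1?ltnS // odd_m (negbTE odd_i) expr1 subrr mulr0 mul0r.
have [a a_gt0 ->] : exists2 a, (0 < a)%N & m = a.*2.
  exists m./2; last by rewrite -[LHS]odd_double_half (negbTE even_m).
  by case: m even_m m_gt0 => [|[|m]].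
have split_even (F : nat -> rat) :
    \sum_(i < a.*2.+1) F i = \sum_(i < a.+1) F i.*2 + \sum_(i < a) F i.*2.+1.
  elim: (a) => [|b IHb]; first by rewrite double0 !big_ord_recl !big_ord0 !addr0.
  rewrite doubleS big_ord_recr [in LHS]big_ord_recr /= IHb.
  by rewrite [X in _ = X + _]big_ord_recr [X in _ = _ + X]big_ord_recr /= doubleS; ring.
rewrite (split_even (fun i => 'C(a.*2, i)%:R * (1 ^+ (a.*2 - i) + (-1) ^+ (a.*2 - i)) * (euler i)%:~R)).
rewrite [X in _ + X]big1 ?addr0 => [|i _]; last first.
  by rewrite /euler /= odd_double mulr0.
rewrite big_ord_recr /= euler_even // -(big_mkord xpredT (fun i => 'C(a.*2, i.*2)%:R * (1 ^+ (a.*2 - i.*2) + (-1) ^+ (a.*2 - i.*2)) * (euler i.*2)%:~R)).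
rewrite binn subnn !expr0 rmorphN rmorph_sum /= big_nat_rev /= add0n.
rewrite big_add1 /= mul1r mulrN mulr_sumr; apply/eqP; rewrite subr_eq0; apply/eqP.
apply: eq_big_nat => i /andP[_ lt_ia].
rewrite -doubleB subKn // expr1n -signr_odd odd_double expr0 -bin_sub ?leq_double ?leq_subr //.
rewrite -doubleB subKn // rmorphM /= -!pmulrn; ring.
Qed.

Lemma umbra_shift N f : (size f <= N)%N ->
  euler_umbra N (f \Po ('X + 1%:P)) + euler_umbra N (f \Po ('X + (-1)%:P)) = 2%:R * f`_0.
Proof.
move=> le_fN.
have umbraE g : euler_umbra N (f \Po g) = \sum_(j < N) f`_j * euler_umbra N (g ^+ j).
  have -> : f \Po g = \sum_(j < N) f`_j *: g ^+ j.
    rewrite comp_polyE (big_ord_widen _ (fun j => f`_j *: g ^+ j) le_fN) big_mkcond /=.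
    apply: eq_bigr => j _; case: ltnP => // le_fj.
    by rewrite nth_default // scale0r.
  rewrite /euler_umbra; under eq_bigr => i _ do rewrite coef_sum mulr_suml.
  rewrite exchange_big /=; apply: eq_bigr => j _; rewrite mulr_sumr.
  by apply: eq_bigr => i _; rewrite coefZ mulrA.
rewrite !umbraE -big_split /=.
have pair j : (j < N)%N -> euler_umbra N (('X + 1%:P) ^+ j) + euler_umbra N (('X + (-1)%:P) ^+ j)
    = 2%:R * (j == 0)%:R.
  move=> lt_jN; rewrite /euler_umbra -big_split /=.
  under eq_bigr => i _ do rewrite !coef_XaddC_exp -mulrDl -mulrDr.
  rewrite -(subnKC lt_jN) big_split_ord /= [X in _ + X]big1 ?addr0 => [|i _]; last first.
    by rewrite bin_small ?mul0r // addSn ltnS leq_addr.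
  case: j lt_jN => [|j] _; last by rewrite sum_euler_binomial // mulr0.
  by rewrite big_ord_recl big_ord0 euler0; ring.
transitivity (\sum_(j < N) (2%:R * f`_0) * (j == 0 :> nat)%:R).
  apply: eq_bigr => j _; rewrite -mulrDr pair //.
  by case: eqP => [->|]; rewrite ?mulr0 // !mulr1 mulrC.
rewrite -mulr_sumr; case: N le_fN {umbraE pair} => [|N] le_fN.
  by rewrite nth_default // !mulr0 mul0r.
by rewrite big_ord_recl big1 ?addr0 ?mulr1.
Qed.

(** Umbrally (E + y)^m; in terms of the classical Euler polynomial it is 2^m E_m((y + 1) / 2). *)
Definition euler_poly m y : rat :=
  \sum_(i < m.+1) 'C(m, i)%:R * y ^+ (m - i) * (euler i)%:~R.

Lemma euler_poly_sum m y :
  euler_poly m (y + 1) + euler_poly m (y - 1) = 2%:R * y ^+ m.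
Proof.
have polyE z : euler_poly m z = euler_umbra m.+1 (('X + z%:P) ^+ m).
  by apply: eq_bigr => i _; rewrite coef_XaddC_exp.
have shift z : ('X + (y + z)%:P) ^+ m = (('X + y%:P) ^+ m) \Po ('X + z%:P).
  by rewrite rmorphXn /= comp_polyD comp_polyX comp_polyC polyCD addrA addrAC.
rewrite !polyE !shift umbra_shift; first by rewrite coef_XaddC_exp bin0 subn0 mul1r.
by rewrite (leq_trans (size_poly_exp_leq _ _)) // size_XaddC mul1n.
Qed.

Lemma euler_poly0 m : euler_poly m 0 = (euler m)%:~R.
Proof.
rewrite /euler_poly big_ord_recr /= subnn binn expr0 !mul1r big1 ?add0r // => i _.
by rewrite expr0n subn_eq0 leqNgt ltn_ord mulr0 mul0r.
Qed.

Lemma euler_polyN m y : ~~ odd m -> euler_poly m (- y) = euler_poly m y.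
Proof.
move=> even_m; apply: eq_bigr => i _.
case: (boolP (odd i)) => odd_i; first by rewrite /euler odd_i !mulr0.
by rewrite exprNn -signr_odd oddB -1?ltnS // (negbTE even_m) (negbTE odd_i) mul1r.
Qed.

Lemma euler_poly1 m : (0 < m)%N -> ~~ odd m -> euler_poly m 1 = 0.
Proof.
move=> m_gt0 even_m; have := euler_poly_sum m 0.
by rewrite add0r sub0r euler_polyN // expr0n gtn_eqF // mulr0; lra.
Qed.

Lemma euler_alternating m N :
  (euler m)%:~R - (-1) ^+ N * euler_poly m N.*2%:R
  = 2%:R * \sum_(i < N) (-1) ^+ i * i.*2.+1%:R ^+ m.
Proof.
elim: N => [|N IHN].
  by rewrite big_ord0 double0 euler_poly0; ring.
rewrite big_ord_recr /= mulrDr -IHN exprS.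
have := euler_poly_sum m N.*2.+1%:R.
rewrite natr1 -[in _ - 1]natr1 addrK -doubleS => h.
by move: h; move: (euler_poly m _) => u h; rewrite mulrCA -h; ring.
Qed.

End EulerFunctional.

(** * Sums of inverse squares modulo p *)

Section QuarterSum.
Variable p : nat.
Hypothesis p_prime : prime p.
Local Notation P := (p%:R : rat).

Lemma sum_Fp (V : nmodType) (F : nat -> V) :
  \sum_(x : 'F_p) F x = \sum_(0 <= j < p) F j.
Proof. by rewrite -(big_mkord xpredT F) Fp_cast. Qed.

Lemma natr_Fp_eq0 a : (a%:R == 0 :> 'F_p) = (p %| a)%N.
Proof. by rewrite (dvdn_pcharf (pchar_Fp p_prime)). Qed.

Lemma Fp_fermat (x : 'F_p) : x != 0 -> x ^+ p.-1 = 1.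
Proof.
move=> x0; apply: (mulfI x0); rewrite -exprS prednK ?prime_gt0 // mulr1.
have e : ((x : nat) ^ p)%N%:R = (x : nat)%:R :> 'F_p.
  by apply/eqP; rewrite -(inj_eq val_inj) /= !val_Fp_nat // fermat_little.
by rewrite natrX natr_Zp in e.
Qed.

Hypothesis p_gt3 : (3 < p)%N.

Lemma p_odd : odd p.
Proof. by have [p2|//] := even_prime p_prime; move: p_gt3; rewrite p2. Qed.

Lemma coprime_p2 : coprime p 2.
Proof. by rewrite coprime_sym coprime2n p_odd. Qed.

Lemma Zloc_2V : 2%:R^-1 \in Zloc p.
Proof. by rewrite Zloc_natV ?coprime_p2. Qed.

Lemma eqloc_inv_sqr a : (0 < a < p)%N -> eqloc p 1 (a%:R ^+ (p - 3)) (a%:R^-1 ^+ 2).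
Proof.
move=> a_p; have co := prime_coprime_small p_prime a_p.
have a0 : a%:R != 0 :> rat by rewrite pnatr_eq0 -lt0n; case/andP: a_p.
have := eqlocMl (rpredX 2 (Zloc_natV co)) (eqloc_fermat p_prime co).
have -> : p.-1 = (2 + (p - 3))%N by move: p_gt3; lia.
by rewrite mulr1 exprD mulrA -exprMn mulVf // expr1n mul1r.
Qed.

(** The substitution x -> 2 x multiplies the sum S over ['F_p] by 2^(p-3) = 1/4, hence 3 S = 0, and
    p > 3. *)
Lemma dvdn_sum_pow : (p %| \sum_(0 <= j < p) j ^ (p - 3))%N.
Proof.
rewrite -natr_Fp_eq0 natr_sum -(sum_Fp (fun j => (j ^ (p - 3))%N%:R)).
have two0 : 2%:R != 0 :> 'F_p.
  by rewrite natr_Fp_eq0 -prime_coprime // coprime_p2.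
under eq_bigr => x _ do rewrite natrX natr_Zp.
set S := \sum_x _; have e : S = 2%:R ^+ (p - 3) * S.
  rewrite {1}/S (reindex_inj (mulfI two0)) mulr_sumr.
  by apply: eq_bigr => x _; rewrite exprMn.
have e4 : 4%:R * 2%:R ^+ (p - 3) = 1 :> 'F_p.
  have -> : 4%:R = 2%:R ^+ 2 :> 'F_p by rewrite -natrX.
  rewrite -exprD; have -> : (2 + (p - 3) = p.-1)%N by move: p_gt3; lia.
  exact: Fp_fermat.
have : 3%:R * S = 0.
  have := congr1 (fun x => 4%:R * x) e; rewrite mulrA e4 mul1r => e'.
  by rewrite -[LHS](addrK S) -{2}[S]mul1r -mulrDl natr1 e' subrr.
move/eqP; rewrite mulf_eq0 natr_Fp_eq0 => /orP[/dvdn_leq|//].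
by move=> /(_ isT); rewrite leqNgt p_gt3.
Qed.

Definition harm2 m : rat := \sum_(j < m) j.+1%:R^-1 ^+ 2.

Lemma harm2S m : harm2 m.+1 = harm2 m + m.+1%:R^-1 ^+ 2.
Proof. by rewrite /harm2 big_ord_recr. Qed.

Lemma harm2_full : eqloc p 1 (harm2 p.-1) 0.
Proof.
have e : (p = p.-1.+1)%N by rewrite prednK ?prime_gt0.
apply: (@eqloc_trans _ _ (\sum_(0 <= j < p) j ^ (p - 3))%N%:R); last first.
  by case/dvdnP: dvdn_sum_pow => q ->; rewrite natrM mulrC -[P]expr1 eqloc_zero ?rpred_nat.
apply: eqloc_sym; rewrite natr_sum {2}e big_nat_recl //= exp0n ?subn_gt0 // add0r.
rewrite big_mkord; apply: eqloc_sum => j _; rewrite natrX.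
by apply: eqloc_inv_sqr => //=; rewrite [X in (_ < X)%N]e ltnS.
Qed.

Lemma eqloc_neg_inv a : (0 < a < p)%N -> eqloc p 1 (p - a)%N%:R^-1 (- a%:R^-1).
Proof.
move=> /[dup] a_p /andP[a_gt0 lt_ap].
have a'_p : (0 < p - a < p)%N by lia.
rewrite -invrN; apply: eqlocV.
- by rewrite pnatr_eq0; lia.
- by rewrite oppr_eq0 pnatr_eq0; lia.
- exact: (Zloc_small_natV p_prime).
- by rewrite invrN rpredN (Zloc_small_natV p_prime).
apply/(eqlocP p_prime); exists 1; first exact: rpred1.
by rewrite natrB 1?ltnW // expr1; ring.
Qed.

(** The terms for j and p - j agree modulo p, so the full sum is twice the half sum. *)
Lemma harm2_half : eqloc p 1 (harm2 p./2) 0.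
Proof.
have pE : p = p./2.*2.+1 by rewrite -[LHS]odd_double_half p_odd.
have z2 : 2%:R != 0 :> rat by [].
apply: (eqloc_cancel z2 Zloc_2V); rewrite mulr0.
apply: eqloc_trans harm2_full; apply: eqloc_sym.
have -> : p.-1 = (p./2 + p./2)%N by rewrite addnn {1}pE.
rewrite /harm2 big_split_ord /= mulr_natl mulr2n; apply: eqlocD; first exact: eqloc_refl.
rewrite (reindex_inj rev_ord_inj) /=; apply: eqloc_sum => j _.
have lt_j := ltn_ord j.
have jp : (0 < j.+1 < p)%N by lia.
have -> : (p./2 + (p./2 - j.+1)).+1 = (p - j.+1)%N by lia.
rewrite -[X in eqloc _ _ _ X]sqrrN.
have Zj := Zloc_small_natV p_prime jp.
apply: eqlocX; rewrite ?rpredN //; last exact: eqloc_neg_inv.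
by apply: (Zloc_small_natV p_prime); lia.
Qed.

(* The Euler polynomial (in this normalization) satisfies
   G (y + 1) + G (y - 1) = 2 y^(p - 3) and vanishes at -1, so going from 0 to
   p - 1 in steps of 2 expresses E_(p - 3) as an alternating power sum. *)
Lemma quarter_sum_inv_sqr n : (4 * n + 3 = p)%N ->
  eqloc p 1 (harm2 n) (- (4%:R * (euler (p - 3))%:~R)).
Proof.
move=> pE; have n_gt0 : (0 < n)%N by move: p_gt3; rewrite -pE; case: (n).
set m := (p - 3)%N; have m_even : ~~ odd m by rewrite /m -pE addnK oddM.
have m_gt0 : (0 < m)%N by rewrite /m; lia.
set N := n.*2.+1; have NE : N = p./2 by rewrite /N; lia.
have Zeuler y : y \in Zloc p -> euler_poly m y \in Zloc p.
  by move=> Zy; rewrite rpred_sum // => i _; rewrite !rpredM ?rpred_int ?rpred_nat ?rpredX.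
have ep_mod : eqloc p 1 (euler_poly m N.*2%:R) 0.
  apply: (@eqloc_trans _ _ (euler_poly m (- 1))).
    apply: eqloc_sum => i _; apply: eqlocMr; first exact: rpred_int.
    apply: eqlocMl; first exact: rpred_nat.
    apply: eqlocX; rewrite ?rpredN ?rpred_nat ?rpred1 //.
    apply/(eqlocP p_prime); exists 1; first exact: rpred1.
    by rewrite -pE /N expr1 mulr1 addrC; apply/eqP; rewrite -subr_eq opprK natr1; apply/eqP; congr (_%:R); lia.
  by rewrite euler_polyN // euler_poly1 // eqloc_refl.
have alt : eqloc p 1 (euler m)%:~R (2%:R^-1 * \sum_(j < N) (-1) ^+ j * j.+1%:R^-1 ^+ 2).
  apply: (@eqloc_trans _ _ ((euler m)%:~R - (-1) ^+ N * euler_poly m N.*2%:R)).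
    apply: eqloc_sym; apply: eqloc_Dzero; rewrite -mulNr.
    rewrite -[X in eqloc _ _ _ X](mulr0 (- (-1) ^+ N)).
    by apply: eqlocMl => //; rewrite rpredN rpred_sign.
  (* As 2 N = p - 1, reversal replaces 2 i + 1 by p - 2 (j + 1): the odd bases become even ones
     modulo p, and the exponent p - 3 makes them inverse squares. *)
  rewrite euler_alternating (reindex_inj rev_ord_inj) /=.
  have -> : 2%:R^-1 = 2%:R * 2%:R^-1 ^+ 2 :> rat by field.
  rewrite -mulrA; apply: eqlocMl; first exact: rpred_nat.
  rewrite mulr_sumr; apply: eqloc_sum => j _; have lt_jN := ltn_ord j.
  have jp : (0 < (j.+1).*2 < p)%N by rewrite -pE -/N; move: lt_jN; rewrite /N; lia.
  have -> : (-1) ^+ (N - j.+1) = (-1) ^+ j :> rat.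
    have o : odd (N - j.+1) = odd j by move: lt_jN; rewrite /N; lia.
    by rewrite -signr_odd o signr_odd.
  rewrite mulrCA; apply: eqlocMl; first by rewrite rpred_sign.
  rewrite -exprMn -invfM -natrM mul2n.
  have -> : (N - j.+1).*2.+1 = (p - j.+1.*2)%N by rewrite /N in lt_jN *; lia.
  apply: (@eqloc_trans _ _ ((- j.+1.*2%:R) ^+ m)).
    apply: eqlocX; rewrite ?rpredN ?rpred_nat //.
    apply/(eqlocP p_prime); exists 1; first exact: rpred1.
    by case/andP: jp => _ lt_jp; rewrite natrB ?(ltnW lt_jp) // expr1; ring.
  by rewrite exprNn -signr_odd (negbTE m_even) mul1r eqloc_inv_sqr.
(* The alternating sum is the full one minus twice its even part, which is [harm2 n] / 4. With N = 2
   n + 1 = (p - 1) / 2, the full sum vanishes modulo p. *)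
have split : \sum_(j < N) (-1) ^+ j * j.+1%:R^-1 ^+ 2 = harm2 N - harm2 n / 2%:R.
  rewrite /N; elim: (n) => [|k IHk].
    by rewrite double0 /harm2 !big_ord_recl !big_ord0 /=; ring.
  rewrite doubleS 2!harm2S [harm2 k.+1]harm2S big_ord_recr.
  rewrite [\sum_(j < k.*2.+2) _]big_ord_recr /= IHk.
  rewrite !exprS -signr_odd odd_double.
  have -> : k.*2.+2%:R = 2%:R * k.+1%:R :> rat by rewrite -natrM mul2n.
  rewrite invfM /= !expr0; move: (k.+1%:R^-1) (k.*2.+3%:R^-1) => c d.
  by field.
have Zh : harm2 n / 2%:R \in Zloc p.
  rewrite rpredM ?Zloc_2V // rpred_sum // => j _; rewrite rpredX //.
  by apply: (Zloc_small_natV p_prime); have := ltn_ord j; rewrite -pE; lia.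
rewrite -mulNr -[harm2 n](_ : - 4%:R * (2%:R^-1 * (0 - harm2 n / 2%:R)) = _); last by field.
apply: eqlocMl; first by rewrite rpredN rpred_nat.
apply: eqloc_sym; apply: eqloc_trans alt _; rewrite split.
apply: eqlocMl; first exact: Zloc_2V.
by apply: eqlocB; [rewrite NE harm2_half | exact: eqloc_refl].
Qed.

End QuarterSum.

(** * Primes congruent to 3 modulo 4 *)

Lemma cubic_norm_inv (p : nat) (t w : rat) (j : nat) : prime p -> t = p%:R * w ->
  w \in Zloc p -> (j.+1 < p)%N ->
  eqloc p 1 (cubic_norm t j.+1)^-1 (j.+1%:R^-1 ^+ 2) /\ (cubic_norm t j.+1)^-1 \in Zloc p.
Proof.
move=> p_prime tE Zw jp; have Zj := @Zloc_small_natV _ p_prime j.+1 jp.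
have Zt : t \in Zloc p by rewrite tE; zloc.
have h : eqloc p 1 (cubic_norm t j.+1) (j.+1%:R ^+ 2).
  apply/(eqlocP p_prime); exists (w * (j.+1%:R + t)); first by zloc.
  by rewrite expr1 /cubic_norm mulrA -tE; ring.
have s0 : j.+1%:R ^+ 2 != 0 :> rat by rewrite expf_neq0 // pnatr_eq0.
have [n0 Zn] : cubic_norm t j.+1 != 0 /\ (cubic_norm t j.+1)^-1 \in Zloc p.
  by apply: (eqloc1_unit p_prime) h _; rewrite // -?exprVn; zloc.
by split => //; rewrite exprVn; apply: eqlocV => //; rewrite -exprVn; zloc.
Qed.

Section FermatQuotient.
Variable p : nat.
Hypothesis p_prime : prime p.
Hypothesis p_gt3 : (3 < p)%N.
Local Notation P := (p%:R : rat).
Local Notation q := (fermat_quotient2 p).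
Lemma fermat_quotient2E : 2%:R ^+ p.-1 = 1 + P * q.
Proof.
have := primeQ_neq0 p_prime; rewrite /fermat_quotient2; move: P => x x0; move: (2%:R ^+ _) => y.
by rewrite mulrCA divff // mulr1 addrC subrK.
Qed.

Lemma fermat_quotient2_Zloc : q \in Zloc p.
Proof.
have := eqloc_fermat p_prime (coprime_p2 p_prime p_gt3).
by rewrite /eqloc expr1.
Qed.
End FermatQuotient.

Section ThreeModFour.
Variables p n : nat.
Hypothesis p_prime : prime p.
Hypothesis p_gt3 : (3 < p)%N.
Hypothesis pE : (4 * n + 3 = p)%N.
Local Notation P := (p%:R : rat).
Local Notation q := (fermat_quotient2 p).
Local Notation E := ((euler (p - 3))%:~R : rat).

Let small_odd i : (i < n.+1)%N -> i.*2.+1%:R^-1 \in Zloc p.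
Proof. by move=> lt_in; apply: (Zloc_small_natV p_prime); rewrite -pE; lia. Qed.

(** The sum involves 2^((p-1)/2), not its square 1 + p q. Working with v, where (1 + p v)^2 = 1 + p
    q, avoids expanding a square root of 1 + p q. *)
Lemma exp4_3mod4 : exists2 v, v \in Zloc p &
  2%:R * 4%:R ^+ n = (-1) ^+ n.+1 * (1 + P * v) /\ q = 2%:R * v + P * v ^+ 2.
Proof.
have e := @exp2_sum_prod n n.+1; rewrite eqxx orbT in e; have {e} := e isT.
have -> : (n + n.+1).*2.+1 = p by rewrite -pE; lia.
set U := \prod_(i < _) _ => e.
have : eqloc p 1 U 1.
  rewrite /U; under eq_bigr => i _ do rewrite -mulrN.
  by apply: eqloc_prod_one => // i _; rewrite rpredN small_odd.
case/(eqlocP p_prime)=> v Zv eU; exists v => //.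
rewrite expr1 in eU; rewrite -eU; split.
  by rewrite -e addnS exprS addnn -mul2n exprM -natrX.
apply: (mulfI (primeQ_neq0 p_prime)); apply: (addrI 1).
rewrite -(fermat_quotient2E p_prime); have -> : p.-1 = ((n + n.+1) * 2)%N by rewrite -pE; lia.
by rewrite exprM e exprMn sqrr_sign eU; ring.
Qed.

(** To first order the product is 1 - t^2 [harm2 n], with t^2 = p^2 / 16 and [harm2 n] = - 4 E
    modulo p. Precision p^3 suffices because a factor p precedes it in [core_congruence]. *)
Lemma norm_product_3mod4 (t : rat) : 4%:R * t = - P ->
  eqloc p 3 (\prod_(j < n) (1 - t ^+ 2 / cubic_norm t j.+1)) (1 + P ^+ 2 * (E / 4%:R)).
Proof.
move=> t_P; have tE : t = P * (- 4%:R^-1) by move: t_P; lra.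
have Z4 : 4%:R^-1 \in Zloc p by apply: Zloc_natV; rewrite (@coprimeXr 2 p 2) ?coprime_p2.
have Zt : t \in Zloc p by rewrite tE; zloc.
have unit_norm j : (j < n)%N ->
    eqloc p 1 (cubic_norm t j.+1)^-1 (j.+1%:R^-1 ^+ 2) /\ (cubic_norm t j.+1)^-1 \in Zloc p.
  by move=> lt_jn; apply: (cubic_norm_inv p_prime tE); rewrite ?rpredN // -pE; lia.
have -> : \prod_(j < n) (1 - t ^+ 2 / cubic_norm t j.+1)
    = \prod_(j < n) (1 + P ^+ 2 * (- (4%:R^-1 ^+ 2 / cubic_norm t j.+1))).
  by apply: eq_bigr => j _; set N := cubic_norm _ _; rewrite [in LHS]tE; ring.
apply: eqloc_trans (@eqloc_weak _ p_prime 3 (2 + 2) _ _ isT (prod_one_plus_pow p_prime 2 _)) _.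
  by move=> j _; have [_ h] := unit_norm j (ltn_ord j); rewrite rpredN rpredM ?rpredX.
apply: eqlocD; first exact: eqloc_refl.
apply: (@eqloc_mulP _ p_prime 2 1).
rewrite sumrN -mulr_sumr.
have -> : E / 4%:R = - (4%:R^-1 ^+ 2 * (- (4%:R * E))) by field.
apply: eqlocN; apply: eqlocMl; first by zloc.
apply: eqloc_trans (quarter_sum_inv_sqr p_prime p_gt3 pE).
by apply: eqloc_sum => j _; case: (unit_norm j (ltn_ord j)).
Qed.

Theorem supercongruence_3mod4 (A : rat) : 4%:R * A = 3%:R ->
  eqloc p 4 (\sum_(0 <= k < p) (8 * k + 3)%:R * gbinom (- A) k ^+ 4)
    ((-1) ^+ n * P * 'C(n.*2, n)%:R
     * (1 - P * (1 + 1 / 2%:R * q)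
        + P ^+ 2 * (1 / 2%:R * q + 3%:R / 8%:R * q ^+ 2 + 1 / 4%:R * E))).
Proof.
move=> A_val; set t := - A - n%:R.
have pR : P = 4%:R * n%:R + 3%:R by rewrite -pE natrD natrM.
have t_P : 4%:R * t = - P by rewrite /t pR; move: A_val; lra.
apply: eqloc_trans (core_congruence p_prime p_gt3 (n := n) (e := 1) _ _ A_val (erefl t)) _.
- by rewrite muln1.
- by rewrite -pE; lia.
have [v Zv [e4 eq]] := exp4_3mod4.
have Z2 := Zloc_2V p_prime p_gt3.
have [u0 Zu] : 1 + P * v != 0 /\ (1 + P * v)^-1 \in Zloc p.
  apply: one_unit => //; apply: eqloc_Dzero => //.
  by rewrite -{1}[P]expr1 eqloc_zero.
(* Both 2 n + 1 = (p - 1) / 2 and 4^n = (-1)^(n+1) (1 + p v) / 2 carry a half; these cancel, and the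
   spare sign turns p - 1 into 1 - p. *)
have -> : P * 1%:R * (n.*2.+1%:R * 'C(n.*2, n)%:R / 4%:R ^+ n)
    = P ^+ 1 * (((-1) ^+ n * 'C(n.*2, n)%:R) * ((1 - P) / (1 + P * v))).
  have n0 : 4%:R ^+ n != 0 :> rat by rewrite expf_neq0.
  have -> : 4%:R ^+ n = (-1) ^+ n.+1 * (1 + P * v) / 2%:R by rewrite -e4; field.
  have -> : n.*2.+1%:R = (P - 1) / 2%:R by rewrite pR -natr1 -mul2n natrM; field.
  rewrite exprS -signr_odd; move: u0; move: ('C(_, _)%:R) (P * v) P => c w x u0.
  by case: odd; rewrite ?expr0 ?expr1; field.
have -> : (-1) ^+ n * P * 'C(n.*2, n)%:R = P ^+ 1 * ((-1) ^+ n * 'C(n.*2, n)%:R).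
  by rewrite expr1; ring.
rewrite -!mulrA; apply: (@eqloc_mulP _ p_prime 1 3).
do 2![apply: eqlocMl; first by rewrite ?rpred_sign ?rpred_nat].
apply: eqloc_trans (eqlocMl _ (eqlocMl Zu (norm_product_3mod4 t_P))) _.
  by rewrite rpredB ?rpred1 ?rpred_nat.
rewrite mulrCA; apply: (eqloc_cancel u0 Zu); rewrite mulVKf //.
(* With 1 + P v cleared and q = 2 v + P v^2 substituted, both sides are polynomials in P, v and E;
   the witness collects all terms from P^3 on. *)
apply/(eqlocP p_prime); rewrite eq.
have ZE : E \in Zloc p by exact: rpred_int.
exists (- (E * 2%:R^-1 ^+ 2 + 3%:R * v ^+ 2 * 2%:R^-1 + 5%:R * v ^+ 3 * 2%:R^-1
  + v * E * 2%:R^-1 ^+ 2 + P * (15%:R * v ^+ 4 * 2%:R^-1 ^+ 3 + v ^+ 3 * 2%:R^-1)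
  + P ^+ 2 * (3%:R * v ^+ 5 * 2%:R^-1 ^+ 3))); first by zloc.
by field.
Qed.

End ThreeModFour.

(** * Jacobsthal sums *)

Section Jacobsthal.
Variables p N : nat.
Hypothesis p_prime : prime p.
Hypothesis pN : p = N.*2.+1.
Local Notation F := 'F_p.
Implicit Types x y k c : F.

Lemma half_gt0 : (0 < N)%N.
Proof. by case: (N) pN p_prime => [->|]. Qed.

Lemma Fp_two_neq0 : 2%:R != 0 :> F.
Proof.
rewrite natr_Fp_eq0 // -prime_coprime // coprime_sym coprime2n pN /=.
by rewrite odd_double.
Qed.

Lemma Fp_exp_double x : x != 0 -> x ^+ N.*2 = 1.
Proof. by move=> x0; rewrite -[RHS](Fp_fermat p_prime x0); congr (x ^+ _); rewrite pN. Qed.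

Definition legendre x : int :=
  if x == 0 then 0 else if x ^+ N == 1 then 1 else -1.

Lemma legendre_Fp x : (legendre x)%:~R = x ^+ N :> F.
Proof.
rewrite /legendre; case: eqVneq => [->|x0].
  by rewrite expr0n gtn_eqF ?half_gt0.
have := Fp_exp_double x0; rewrite -muln2 exprM => /eqP; rewrite -subr_eq0 subr_sqr_1.
rewrite mulf_eq0 subr_eq0 addr_eq0; case: eqVneq => [->//|_ /= /eqP->].
by rewrite rmorphN.
Qed.

Lemma legendre_values x : legendre x \in [:: 0; 1; -1].
Proof. by rewrite /legendre; do 2?[case: ifP => // _]. Qed.

(** Integer identities between character values can thus be checked in ['F_p], where Euler's
    criterion makes the character a power. *)
Lemma sign_Fp_inj (a b : int) : a \in [:: 0; 1; -1] -> b \in [:: 0; 1; -1] ->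
  a%:~R = b%:~R :> F -> a = b.
Proof.
have one0 := oner_neq0 F; have two0 := Fp_two_neq0.
have mone : 1 <> -1 :> F by move=> h; move/eqP: two0; apply; rewrite mulr2n {2}h subrr.
have mone0 : -1 <> 0 :> F by apply/eqP; rewrite oppr_eq0.
by rewrite !inE => /or3P[]/eqP-> /or3P[]/eqP-> //=; rewrite ?rmorphN ?rmorph0 ?rmorph1 => h //;
  first [case: (mone h) | case: (mone (esym h)) | case: (mone0 h) | case: (mone0 (esym h))
        | case/eqP: one0].
Qed.

Lemma legendreM x y : legendre (x * y) = legendre x * legendre y.
Proof.
apply: sign_Fp_inj; rewrite ?legendre_values //.
  have := legendre_values x; have := legendre_values y.
  by rewrite !inE => /or3P[]/eqP-> /or3P[]/eqP->.
by rewrite rmorphM /= !legendre_Fp exprMn.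
Qed.

Lemma legendre0 : legendre 0 = 0. Proof. by rewrite /legendre eqxx. Qed.

Lemma legendre1 : legendre 1 = 1.
Proof. by rewrite /legendre oner_eq0 expr1n eqxx. Qed.

Lemma legendre_sqr x : x != 0 -> legendre (x ^+ 2) = 1.
Proof. by move=> x0; rewrite /legendre expf_eq0 (negbTE x0) -exprM mul2n Fp_exp_double ?eqxx. Qed.

Lemma legendre_sqr_int x : x != 0 -> legendre x ^+ 2 = 1.
Proof. by move=> x0; rewrite expr2 -legendreM -expr2 legendre_sqr. Qed.

Lemma legendre_cube x : legendre (x ^+ 3) = legendre x.
Proof.
case: (eqVneq x 0) => [->|x0]; first by rewrite expr0n.
by rewrite exprS legendreM legendre_sqr // mulr1.
Qed.

Lemma Fp_primitive_root : exists g : F, N.*2.-primitive_root g.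
Proof.
pose rs := [seq x <- enum F | x != 0].
have szE : size rs = N.*2.
  rewrite size_filter -[LHS]addn0; apply: succn_inj; rewrite addn0.
  have := count_predC (pred1 (0 : F)) (enum F).
  have szF : size (enum F) = N.*2.+1 by rewrite -cardE card_Fp.
  by rewrite (count_uniq_mem _ (enum_uniq _)) mem_enum szF add1n.
have /hasP[g _ pg] : has N.*2.-primitive_root rs; last by exists g.
apply: has_prim_root; rewrite ?szE ?double_gt0 ?half_gt0 ?filter_uniq -?enumT ?enum_uniq //.
by apply/allP => x; rewrite mem_filter => /andP[x0 _]; rewrite unity_rootE Fp_exp_double.
Qed.

Variable g : F.
Hypothesis g_prim : N.*2.-primitive_root g.

Lemma prim_root_neq0 : g != 0.
Proof.
apply/eqP=> g0; have := prim_expr_order g_prim; rewrite g0.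
by rewrite expr0n gtn_eqF ?double_gt0 ?half_gt0 // => /esym/eqP; rewrite oner_eq0.
Qed.

Lemma prim_root_half : g ^+ N = -1.
Proof.
have := Fp_exp_double prim_root_neq0; rewrite -muln2 exprM => /eqP.
rewrite -subr_eq0 subr_sqr_1 mulf_eq0 subr_eq0 addr_eq0 => /orP[|/eqP//].
by rewrite -(prim_order_dvd g_prim) gtnNdvd ?half_gt0 // -addnn -{1}[N]addn0 ltn_add2l half_gt0.
Qed.

Lemma legendre_prim_root : legendre g = -1.
Proof.
rewrite /legendre (negbTE prim_root_neq0) prim_root_half.
case: eqP => // /esym h; have := Fp_two_neq0.
by rewrite mulr2n {2}h subrr eqxx.
Qed.

Lemma sum_nonzero (V : nmodType) (f : F -> V) :
  \sum_(x | x != 0) f x = \sum_(i < N.*2) f (g ^+ i).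
Proof.
pose h (i : 'I_N.*2) := g ^+ i.
have inj : injective h.
  move=> i j /eqP; rewrite (eq_prim_root_expr g_prim) !modn_small // => /eqP ij.
  exact: val_inj.
rewrite -(big_imset (h := h) f) => [/=|i j _ _]; last exact: inj.
apply: eq_bigl => x; have : [set h i | i in 'I_N.*2] = [set x | x != 0].
  apply/eqP; rewrite eqEcard card_imset // card_ord; apply/andP; split.
    by apply/subsetP=> _ /imsetP[i _ ->]; rewrite inE expf_neq0 ?prim_root_neq0.
  have -> : [set x : F | x != 0] = [set~ 0] by apply/setP=> y; rewrite !inE.
  by rewrite cardsC1 card_Fp // [p in p.-1]pN.
by move/setP/(_ x) => ->; rewrite inE.
Qed.

Lemma sum_legendre : \sum_x legendre x = 0.
Proof.
set S := LHS; suff : S = - S by lia.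
rewrite {2}/S -sumrN /S (reindex_inj (mulfI prim_root_neq0)) /=; apply: eq_bigr => x _.
by rewrite legendreM legendre_prim_root mulN1r.
Qed.

(** For a != b, shifting gives k (k + b - a) = k^2 (1 + (b - a) / k). Since (b - a) / k runs over
    all nonzero elements, the sum is that of the character over everything except 1. *)
Lemma sum_legendre_pair (a b : F) :
  \sum_k legendre ((a - k) * (b - k)) = if a == b then N.*2%:Z else -1.
Proof.
case: eqVneq => [<-|ne_ab].
  rewrite (bigD1 a) //= subrr mul0r legendre0 add0r.
  rewrite (eq_bigr (fun=> 1)) => [|k ne_ka]; last first.
    by rewrite -expr2 legendre_sqr // subr_eq0 eq_sym.
  by rewrite (eq_bigl (mem (predC1 a))) // sumr_const cardC1 card_Fp // pN natz.
have d0 : b - a != 0 by rewrite subr_eq0 eq_sym.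
have subK' : involutive (fun k => a - k) by move=> k; rewrite opprB addrC subrK.
rewrite (reindex_inj (inv_inj subK')) (bigD1 0) //= subr0 subrr mul0r legendre0 add0r.
transitivity (\sum_(k | k != 0) legendre (1 + (b - a) / k)).
  apply: eq_bigr => k k0; rewrite opprB addrC subrK.
  have -> : k * (b + (k - a)) = k ^+ 2 * (1 + (b - a) / k) by field.
  by rewrite legendreM legendre_sqr // mul1r.
have invD k : k != 0 -> (b - a) / ((b - a) / k) = k by move=> k0; field; rewrite d0 k0.
rewrite (reindex_onto (fun k => (b - a) / k) (fun k => (b - a) / k)) => [/=|k]; last exact: invD.
transitivity (\sum_(k | k != 0) legendre (1 + k)).
  apply: eq_big => k.
    by case: (eqVneq k 0) => [->|k0]; rewrite ?invr0 ?mulr0 ?eqxx // mulf_neq0 ?invr_eq0 // invD ?eqxx.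
  by case/andP=> _ /eqP ->.
have := sum_legendre; rewrite (reindex_inj (addrI 1)) (bigD1 0) //= addr0 legendre1.
by move=> h; apply: (addrI 1); rewrite h.
Qed.

(** For k != 0 this is minus the trace of Frobenius of y^2 = x^3 - k x. The parameter k varies
    because the size is found from the mean square over all k. *)
Definition jacobsthal_sum k : int := \sum_x legendre (x ^+ 3 - k * x).

Lemma jacobsthal_sum_scale c k : c != 0 ->
  jacobsthal_sum (c ^+ 2 * k) = legendre c * jacobsthal_sum k.
Proof.
move=> c0; rewrite /jacobsthal_sum (reindex_inj (mulfI c0)) mulr_sumr /=.
apply: eq_bigr => x _; rewrite -(legendre_cube c) -legendreM.
by congr legendre; ring.
Qed.

Lemma jacobsthal_sum0 : jacobsthal_sum 0 = 0.
Proof.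
rewrite -[RHS]sum_legendre; apply: eq_bigr => x _.
by rewrite mul0r subr0 legendre_cube.
Qed.

Hypothesis legendreN1 : legendre (-1) = 1.

Lemma legendreN x : legendre (- x) = legendre x.
Proof. by rewrite -mulN1r legendreM legendreN1 mul1r. Qed.

(* Expanding the square and summing over k first leaves y = x and y = - x. *)
Lemma sum_jacobsthal_sqr :
  \sum_k jacobsthal_sum k ^+ 2 = 2%:R * p%:Z * N.*2%:Z.
Proof.
have prodE k : jacobsthal_sum k ^+ 2 =
    \sum_x \sum_y legendre (x * y) * legendre ((x ^+ 2 - k) * (y ^+ 2 - k)).
  rewrite expr2 /jacobsthal_sum big_distrlr /=; apply: eq_bigr => x _; apply: eq_bigr => y _.
  by rewrite -!legendreM; congr legendre; ring.
under eq_bigr => k _ do rewrite prodE.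
rewrite exchange_big /=.
transitivity (\sum_x (\sum_y legendre (x * y) * (if x ^+ 2 == y ^+ 2 then p%:Z else 0)
                     - \sum_y legendre (x * y))).
  apply: eq_bigr => x _; rewrite exchange_big /= -sumrB; apply: eq_bigr => y _.
  rewrite -mulr_sumr sum_legendre_pair -[X in _ = _ - X]mulr1 -mulrBr; congr (_ * _).
  by case: eqP => _; rewrite ?sub0r // pN -[N.*2.+1]addn1 PoszD addrK.
have sum_xy x : \sum_y legendre (x * y) = 0.
  under eq_bigr => y _ do rewrite legendreM.
  by rewrite -mulr_sumr sum_legendre mulr0.
under eq_bigr => x _ do rewrite sum_xy subr0.
rewrite (bigD1 0) //= [X in X + _]big1 ?add0r => [|y _]; last by rewrite !mul0r.
rewrite (eq_bigr (fun=> 2%:R * p%:Z)) => [|x x0].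
  rewrite (eq_bigl (mem (predC1 0))) // sumr_const cardC1 card_Fp // {2}pN.
  by rewrite /= -[LHS]mulr_natr (natz N.*2).
have xNx : - x != x.
  rewrite -subr_eq0 -opprD oppr_eq0 -mulr2n -mulr_natl mulf_neq0 ?Fp_two_neq0 //.
rewrite (bigD1 x) //= (bigD1 (- x)) //= !eqxx sqrrN eqxx mulrN legendreN -expr2 legendre_sqr //.
rewrite big1 ?addr0 => [|y /andP[yx yNx]]; first by rewrite !mul1r mulr_natl mulr2n.
rewrite eqf_sqr eq_sym (negbTE yx) /= -eqr_oppLR eq_sym (negbTE yNx) mulr0 //.
Qed.

(** By [jacobsthal_sum_scale] the square depends only on whether k is a square, so the sum over k !=
    0 is N times the left-hand side. *)
Lemma jacobsthal_sum_squares :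
  jacobsthal_sum 1 ^+ 2 + jacobsthal_sum g ^+ 2 = 4%:R * p%:Z.
Proof.
have g0 := prim_root_neq0.
have even j : jacobsthal_sum (g ^+ j.*2) ^+ 2 = jacobsthal_sum 1 ^+ 2.
  rewrite -muln2 exprM -[(g ^+ j) ^+ 2]mulr1 jacobsthal_sum_scale ?expf_neq0 //.
  by rewrite exprMn legendre_sqr_int ?mul1r ?expf_neq0.
have odd j : jacobsthal_sum (g ^+ j.*2.+1) ^+ 2 = jacobsthal_sum g ^+ 2.
  rewrite [g ^+ _.+1]exprSr -muln2 exprM jacobsthal_sum_scale ?expf_neq0 //.
  by rewrite exprMn legendre_sqr_int ?mul1r ?expf_neq0.
have := sum_jacobsthal_sqr.
rewrite (bigD1 0) //= jacobsthal_sum0 expr0n add0r sum_nonzero.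
have -> : \sum_(i < N.*2) jacobsthal_sum (g ^+ i) ^+ 2
   = N%:Z * (jacobsthal_sum 1 ^+ 2 + jacobsthal_sum g ^+ 2).
  elim: (N) => [|M IHM]; first by rewrite big_ord0 mul0r.
  by rewrite doubleS 2!big_ord_recr /= IHM even odd (intS M); ring.
have N0 : N%:Z != 0 by rewrite -lt0n half_gt0.
move=> e; apply: (mulfI N0); rewrite e -addnn PoszD; ring.
Qed.

End Jacobsthal.

(** Since p divides (x a - y b) (x a + y b), up to the sign of b it divides x a - y b. In (x a - y
    b)^2 + (x b + y a)^2 = p^2 the first term is nonzero by parity, so it is all of p^2 and x b = -
    y a. *)
Lemma two_squares_unique (p : nat) (x y a b : int) : prime p -> (2 < p)%N ->
  p%:Z = x ^+ 2 + y ^+ 2 -> p%:Z = a ^+ 2 + b ^+ 2 ->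
  (x %% 2 = 1)%Z -> (a %% 2 = 1)%Z -> a = x \/ a = - x.
Proof.
move=> p_pr p_gt2 e1 e2 x_odd a_odd.
have p_odd' : odd p by case: (even_prime p_pr) p_gt2 => [->|].
have y_even : (y %% 2 = 0)%Z by move: e1; rewrite !expr2; nia.
have b_even : (b %% 2 = 0)%Z by move: e2; rewrite !expr2; nia.
have : (p%:Z %| (x * a - y * b) * (x * a + y * b))%Z.
  apply/dvdzP; exists (x ^+ 2 + a ^+ 2 - p%:Z); rewrite -subr_sqr !exprMn.
  have -> : y ^+ 2 = p%:Z - x ^+ 2 by rewrite e1 addrAC subrr add0r.
  have -> : b ^+ 2 = p%:Z - a ^+ 2 by rewrite e2 addrAC subrr add0r.
  by ring.
have key c : p%:Z = a ^+ 2 + c ^+ 2 -> (c %% 2 = 0)%Z -> (p%:Z %| x * a - y * c)%Z ->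
    a = x \/ a = - x.
  move=> e3 c_even /dvdzP[k ek].
  have e4 : (x * a - y * c) ^+ 2 + (x * c + y * a) ^+ 2 = p%:Z ^+ 2.
    by rewrite [in RHS]expr2 {1}e1 e3; ring.
  have k0 : k != 0.
    apply/eqP=> k0; move: ek; rewrite k0 mul0r => /eqP; rewrite subr_eq0 => /eqP e5.
    have : ((x * a) %% 2 = 1)%Z by rewrite -modzMml x_odd mul1r.
    by rewrite e5 -modzMml y_even mul0r.
  have e6 : x * c + y * a = 0.
    have p0 : 0 < p%:Z :> int by rewrite ltz_nat prime_gt0.
    have k1 : 1 <= k ^+ 2 by rewrite -gtz0_ge1 exprn_even_gt0.
    apply/eqP; rewrite -sqrf_eq0 eq_le sqr_ge0 andbT.
    have -> : (x * c + y * a) ^+ 2 = p%:Z ^+ 2 * (1 - k ^+ 2) by rewrite mulrBr mulr1 -{1}e4 ek; ring.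
    by rewrite mulr_ge0_le0 ?sqr_ge0 // subr_le0.
  have e7 : (x * c) ^+ 2 = (y * a) ^+ 2.
    by move/eqP: e6; rewrite addr_eq0 => /eqP ->; rewrite sqrrN.
  have p0 : p%:Z != 0 by rewrite -lt0n prime_gt0.
  have : x ^+ 2 = a ^+ 2.
    apply: (mulIf p0); move: e7; rewrite !exprMn.
    have -> : c ^+ 2 = p%:Z - a ^+ 2 by rewrite e3 addrAC subrr add0r.
    have -> : y ^+ 2 = p%:Z - x ^+ 2 by rewrite e1 addrAC subrr add0r.
    move=> h; have -> : x ^+ 2 * p%:Z = x ^+ 2 * (p%:Z - a ^+ 2) + x ^+ 2 * a ^+ 2 by ring.
    by rewrite h; ring.
  by move/eqP; rewrite eq_sym eqf_sqr => /orP[]/eqP; [left|right].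
have pdvd u v : (p%:Z %| u * v)%Z -> (p%:Z %| u)%Z \/ (p%:Z %| v)%Z.
  by rewrite !dvdzE abszM Euclid_dvdM // => /orP.
case/pdvd; first exact: key.
by rewrite -[y * b]opprK -mulrN => h; apply: (key (- b)) => //; rewrite ?sqrrN //; lia.
Qed.

(** * The value and sign of the Jacobsthal sum of x^3 - x *)

Section JacobsthalTwoSquares.
Variables p m : nat.
Hypothesis p_prime : prime p.
Hypothesis pm : p = (4 * m).+1.
Local Notation F := 'F_p.
Local Notation chi := (@legendre p m.*2).

Let pN : p = m.*2.*2.+1. Proof. by rewrite pm; lia. Qed.

Let m_gt0 : (0 < m)%N.
Proof. by have := half_gt0 p_prime pN; rewrite double_gt0. Qed.

Lemma legendreN1_1mod4 : chi (-1) = 1.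
Proof. by rewrite /legendre oppr_eq0 oner_eq0 -signr_odd odd_double eqxx. Qed.

Variable g : F.
Hypothesis g_prim : m.*2.*2.-primitive_root g.

Let g0 := prim_root_neq0 p_prime pN g_prim.
Let gN := prim_root_half p_prime pN g_prim.

Let h k i : int := chi ((g ^+ i) ^+ 3 - k * g ^+ i).

Let h_periodic k i : h k (m.*2 + i) = h k i.
Proof.
rewrite /h exprD gN -[RHS](legendreN p_prime pN legendreN1_1mod4).
by congr legendre; ring.
Qed.

Let sum_double n (f : nat -> int) :
  \sum_(i < n.*2) f i = \sum_(i < n) f i + \sum_(i < n) f (n + i)%N.
Proof. by rewrite -addnn big_split_ord. Qed.

Let sum_head (f : nat -> int) : \sum_(i < m) f i = f 0 + \sum_(i < m.-1) f i.+1.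
Proof. by move: m_gt0 f; clear; case: m => // n _ f; rewrite big_ord_recl. Qed.

Lemma jacobsthal_sum_half k :
  jacobsthal_sum m.*2 k = 2%:R * \sum_(i < m.*2) h k i.
Proof.
rewrite /jacobsthal_sum (bigD1 0) //= expr0n mulr0 subr0 legendre0 add0r.
rewrite (sum_nonzero p_prime pN g_prim) (sum_double m.*2 (h k)).
rewrite mulr_natl mulr2n; congr (_ + _); apply: eq_bigr => i _; exact: h_periodic.
Qed.

Let h_rev i : (i < m.*2)%N -> h 1 (m.*2 - i) = h 1 i.
Proof.
move=> lt_i; have gi0 : g ^+ i != 0 by rewrite expf_neq0.
have e : g ^+ (m.*2 - i) = - (g ^+ i)^-1.
  by apply: (mulIf gi0); rewrite -exprD subnK 1?ltnW // gN mulNr mulVf.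
rewrite /h e; move: (g ^+ i) gi0 => x x0.
have -> : (- x^-1) ^+ 3 - 1 * - x^-1 = (x^-1 ^+ 2) ^+ 2 * (x ^+ 3 - 1 * x) by field.
by rewrite legendreM // legendre_sqr ?mul1r ?expf_neq0 ?invr_eq0.
Qed.

Let h_mid : h 1 m = 1.
Proof.
rewrite /h; set w := g ^+ m.
have ww : w ^+ 2 = -1 by rewrite -exprM muln2.
have -> : w ^+ 3 - 1 * w = - (1 + w) ^+ 2.
  have -> : (1 + w) ^+ 2 = 1 + 2%:R * w + w ^+ 2 by ring.
  by rewrite exprS ww; ring.
rewrite (legendreN p_prime pN legendreN1_1mod4) legendre_sqr //.
apply/eqP=> /eqP; rewrite addrC addr_eq0 => /eqP w1; move: ww; rewrite w1 sqrrN expr1n.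
move=> h1; have := Fp_two_neq0 p_prime pN; by rewrite mulr2n {2}h1 subrr eqxx.
Qed.

Let h_odd i : (0 < i < m)%N -> exists z : int, h 1 i = 1 + 2%:R * z.
Proof.
case/andP=> i_gt0 lt_im.
have : (g ^+ i) ^+ 3 - 1 * g ^+ i != 0.
  have -> : (g ^+ i) ^+ 3 - 1 * g ^+ i = g ^+ i * (g ^+ i.*2 - 1) by rewrite -muln2 exprM; ring.
  rewrite mulf_neq0 ?expf_neq0 // subr_eq0 -(prim_order_dvd g_prim) gtnNdvd ?double_gt0 //.
  by rewrite ltn_double; lia.
rewrite /h /legendre => /negbTE ->; case: ifP => _; first by exists 0.
by exists (-1).
Qed.

(** Fixes half the sum modulo 4. Modulo x -> - x, the symmetry x -> - 1 / x pairs the exponents i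
    and 2 m - i. Only i = 0, with value 0, and i = m, with value 1, stay alone; the m - 1 pairs have
    odd values. *)
Lemma jacobsthal_sum_1 : exists z : int,
  jacobsthal_sum m.*2 (1 : F) = 2%:R * (1 + 2%:R * (m.-1%:Z + 2%:R * z)).
Proof.
have [z ez] : exists z : int, \sum_(i < m.-1) h 1 i.+1 = m.-1%:Z + 2%:R * z.
  suff /(_ m.-1 (leqnn _)) : forall l, (l <= m.-1)%N ->
    exists z : int, \sum_(i < l) h 1 i.+1 = l%:Z + 2%:R * z by [].
  elim=> [_|l IHl lt_l]; first by exists 0; rewrite big_ord0.
  have [z ez] := IHl (ltnW lt_l); have [|w ew] := @h_odd l.+1; first by lia.
  by exists (z + w); rewrite big_ord_recr /= ez ew (intS l); ring.
exists z; rewrite jacobsthal_sum_half -ez; congr (_ * _).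
rewrite sum_double (sum_head (h 1)) (sum_head (fun i => h 1 (m + i))).
have -> : h 1 0 = 0 by rewrite /h expr0 expr1n mulr1 subrr legendre0.
rewrite addn0 h_mid add0r addrC -addrA; congr (_ + _).
rewrite mulr_natl mulr2n; congr (_ + _).
rewrite (reindex_inj rev_ord_inj) /=; apply: eq_bigr => i _.
rewrite -[in RHS]h_rev; last by have := ltn_ord i; lia.
by congr (h 1 _); have := ltn_ord i; lia.
Qed.

(** Both sums in [jacobsthal_sum_squares] are even, so their halves write p as a sum of two squares
    with the first base odd. Hence that base is x or - x, and its residue modulo 4 decides. *)
Lemma jacobsthal_sum_two_squares (x y : int) :
  p%:Z = x ^+ 2 + y ^+ 2 -> (4 %| x - 1)%Z ->
  jacobsthal_sum m.*2 (1 : F) = - ((-1) ^+ m * (2%:R * x)).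
Proof.
move=> pxy x1; have [z ez] := jacobsthal_sum_1.
have := jacobsthal_sum_squares p_prime pN g_prim legendreN1_1mod4.
rewrite ez jacobsthal_sum_half; set b := \sum_(i < _) _ => e.
set a := 1 + _ in ez e *.
have pab : p%:Z = a ^+ 2 + b ^+ 2.
  by apply: (@mulfI _ (4%:R : int)) => //; rewrite -e; ring.
have p_gt2 : (2 < p)%N by rewrite pm; lia.
have [||ax|ax] := two_squares_unique p_prime p_gt2 pxy pab; rewrite ?ax.
- by move: x1; lia.
- by rewrite /a; lia.
- have m_odd : odd m by move: ax x1; rewrite /a; lia.
  by rewrite -signr_odd m_odd; ring.
have m_even : odd m = false by move: ax x1; rewrite /a; lia.
by rewrite -signr_odd m_even; ring.
Qed.

End JacobsthalTwoSquares.

(** * The Jacobsthal sum modulo p^2 *)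

Section TeichmullerSum.
Variables p m : nat.
Hypothesis p_prime : prime p.
Hypothesis pm : p = (4 * m).+1.
Hypothesis m_gt0 : (0 < m)%N.
Local Notation F := 'F_p.
Local Notation P := (p%:R : rat).

Let pN : p = m.*2.*2.+1. Proof. by rewrite pm; lia. Qed.

Lemma intr_Fp_eq0 (z : int) : (z%:~R == 0 :> F) = (p%:Z %| z)%Z.
Proof.
case: z => n; first by rewrite dvdzE /= -natr_Fp_eq0.
by rewrite NegzE rmorphN oppr_eq0 dvdzE abszN /= -natr_Fp_eq0.
Qed.

(* If l = z^((p-1)/2) (1 + O(p)) with l = 1 or -1, then Y = z^((p-1)/2) satisfies
   Y (3 - Y^2) = 2 l + O(p^2), as l is a critical point of Y (3 - Y^2). *)
Lemma legendre_eqloc (z : int) :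
  eqloc p 2 (z%:~R ^+ m.*2 * (3%:R - z%:~R ^+ (2 * m.*2)))
    (2%:R * (legendre m.*2 (z%:~R : F))%:~R).
Proof.
case: (eqVneq (z%:~R : F) 0) => [/eqP|z0].
  rewrite intr_Fp_eq0 => /dvdzP[w ->]; rewrite rmorphM /=.
  have -> : legendre m.*2 ((w * p%:Z)%:~R : F) = 0.
    have -> : (w * p%:Z)%:~R = 0 :> F by apply/eqP; rewrite intr_Fp_eq0 dvdz_mull.
    exact: legendre0.
  rewrite mulr0; have -> : m.*2 = (2 + (m.-1).*2)%N by lia.
  set x := 3%:R - _; have Zx : x \in Zloc p by rewrite rpredB ?rpredX ?rpredM ?rpred_nat ?rpred_int.
  move: x Zx => x Zx; rewrite exprD exprMn -[p%:~R]/(P).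
  have -> : w%:~R ^+ 2 * P ^+ 2 * (w%:~R * P) ^+ m.-1.*2 * x = P ^+ 2 * (w%:~R ^+ 2 * (w%:~R * P) ^+ m.-1.*2 * x) by ring.
  by apply: eqloc_zero => //; do ![apply: rpredM|apply: rpredX|exact: rpred_int|exact: rpred_nat|exact: Zx].
have := legendre_sqr_int p_prime pN z0.
have := legendre_Fp p_prime pN (z%:~R : F).
set l := legendre _ _ => e l2.
have /dvdzP[a ea] : (p%:Z %| z ^+ m.*2 - l)%Z.
  by rewrite -intr_Fp_eq0 rmorphB rmorphXn /= e subrr.
have {}ea : z%:~R ^+ m.*2 = l%:~R + P * a%:~R :> rat.
  by rewrite -rmorphXn -[P]/(p%:~R) -rmorphM -rmorphD /= mulrC -ea addrC subrK.
have {}l2 : l%:~R * l%:~R = 1 :> rat by rewrite -rmorphM -expr2 /= l2.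
rewrite mulnC exprM ea; move: (rpred_int (Zloc p) l) (rpred_int (Zloc p) a).
move: (l%:~R : rat) (a%:~R : rat) l2 => u v uu Zu Zv.
apply/(eqlocP p_prime); exists (- (3%:R * u * v ^+ 2 + P * v ^+ 3)); first by zloc.
transitivity (2%:R * u + P ^+ 2 * (- (3%:R * u * v ^+ 2 + P * v ^+ 3))
              + (1 - u * u) * (u + 3%:R * P * v)); first by ring.
by rewrite uu subrr mul0r addr0.
Qed.

Variable g : F.
Hypothesis g_prim : m.*2.*2.-primitive_root g.

(* The powers of this integer represent, modulo p^2, the Teichmueller lifts
   of the nonzero residues. *)
Let G : nat := ((g : nat) ^ p)%N.

Let G_Fp : G%:R = g.
Proof.
rewrite /G natrX natr_Zp; have g0 := prim_root_neq0 p_prime pN g_prim.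
have -> : g ^+ p = g ^+ p.-1.+1 by rewrite prednK ?prime_gt0.
by rewrite exprS Fp_fermat // mulr1.
Qed.

Let G_gt0 : (0 < G)%N.
Proof.
rewrite lt0n; apply/eqP=> G0; have := G_Fp; rewrite G0 => /esym/eqP.
by rewrite (negbTE (prim_root_neq0 p_prime pN g_prim)).
Qed.

Let G_order : eqloc p 2 (G%:R ^+ (4 * m)) 1.
Proof.
rewrite -natrX; apply: (@eqloc_modn_pow p p_prime 2 _ 1); rewrite /G -expnM.
have -> : (p * (4 * m) = totient (p ^ 2))%N.
  by rewrite totient_pfactor // expn1 [in p.-1]pm mulnC.
rewrite Euler_exp_totient // coprimeXr // coprime_sym prime_coprime //.
by rewrite -natr_Fp_eq0 // natr_Zp (prim_root_neq0 p_prime pN g_prim).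
Qed.

Let G_pow_order M : (4 * m %| M)%N -> eqloc p 2 (G%:R ^+ M) 1.
Proof.
case/dvdnP=> k ->; rewrite mulnC exprM -[X in eqloc _ _ _ X](expr1n _ k).
by apply: eqlocX; [rewrite rpredX ?rpred_nat | rewrite rpred1 | exact: G_order].
Qed.

(** Orthogonality of roots of unity: when 4 m does not divide M, G^M - 1 is a unit because g^M != 1
    in ['F_p], so the geometric sum vanishes modulo p^2 and not merely modulo p. *)
Let power_sum M : eqloc p 2 (\sum_(i < 4 * m) G%:R ^+ (i * M))
                          ((4 * m %| M)%N%:R * (4 * m)%:R).
Proof.
case: (boolP (4 * m %| M)%N) => dM.
  have -> : true%:R * (4 * m)%:R = \sum_(i < 4 * m) 1 :> rat.
    by rewrite mul1r sumr_const card_ord.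
  apply: eqloc_sum => i _.
  by apply: G_pow_order; rewrite dvdn_mull.
have e : (G%:R ^+ M - 1) * \sum_(i < 4 * m) G%:R ^+ (i * M) = G%:R ^+ (M * (4 * m)) - 1 :> rat.
  rewrite exprM [RHS]subrX1; congr (_ * _).
  by apply: eq_bigr => i _; rewrite -exprM mulnC.
have e' : G%:R ^+ M - 1 = (G ^ M - 1)%N%:R :> rat by rewrite natrB ?natrX // expn_gt0 G_gt0.
have nd : ~~ (p %| G ^ M - 1)%N.
  have eF : (G ^ M - 1)%N%:R = g ^+ M - 1 :> F.
    by rewrite natrB; [rewrite natrX G_Fp | rewrite expn_gt0 G_gt0].
  rewrite -natr_Fp_eq0 // eF subr_eq0.
  by rewrite -(prim_order_dvd g_prim); have -> : m.*2.*2 = (4 * m)%N by lia.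
have u0 : G%:R ^+ M - 1 != 0 :> rat.
  by rewrite e' pnatr_eq0; apply: contraNneq nd => ->; rewrite dvdn0.
apply: (eqloc_cancel u0); first by rewrite e' Zloc_natV // prime_coprime.
rewrite e mul0r mulr0 -[X in eqloc _ _ _ X](subrr 1); apply: eqlocB; last exact: eqloc_refl.
by apply: G_pow_order; rewrite dvdn_mull.
Qed.

Let z i : int := (G ^ i)%N%:Z ^+ 3 - (G ^ i)%N%:Z.

Let z_rat i : (z i)%:~R = (G%:R ^+ i) ^+ 3 - G%:R ^+ i :> rat.
Proof. by rewrite /z rmorphB rmorphXn /= -!pmulrn natrX. Qed.

(** The j-th binomial term of (G^(3 i) - G^i)^n is a power of G^i with exponent 3 n - 2 j.
    Divisibility by 4 m leaves j = m for n = 2 m, and j = m, 3 m, 5 m for n = 6 m. *)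
Let cubic_power_sum n :
  eqloc p 2 (\sum_(i < 4 * m) (z i)%:~R ^+ n)
    ((4 * m)%:R * \sum_(j < n.+1) (-1) ^+ j * 'C(n, j)%:R * (4 * m %| 3 * n - 2 * j)%N%:R).
Proof.
have -> : \sum_(i < 4 * m) (z i)%:~R ^+ n
   = \sum_(j < n.+1) (-1) ^+ j * 'C(n, j)%:R * \sum_(i < 4 * m) G%:R ^+ (i * (3 * n - 2 * j)) :> rat.
  under [RHS]eq_bigr => j _ do rewrite mulr_sumr.
  rewrite exchange_big /=; apply: eq_bigr => i _; rewrite z_rat exprBn.
  apply: eq_bigr => j _; have le_jn : (j <= n)%N by rewrite -ltnS.
  have -> : (i * (3 * n - 2 * j) = i * 3 * (n - j) + i * j)%N by nia.
  by rewrite -mulr_natr exprD !exprM; ring.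
rewrite mulr_sumr; apply: eqloc_sum => j _.
rewrite mulrCA; apply: eqlocMl; first by rewrite rpredM ?rpred_sign ?rpred_nat.
by rewrite mulrC; apply: power_sum.
Qed.

Let bin_rev : 'C(6 * m, 5 * m) = 'C(6 * m, m).
Proof. by rewrite -bin_sub; [congr 'C(_, _); lia | lia]. Qed.

Let sum_single n : n = (2 * m)%N ->
  \sum_(j < n.+1) (-1) ^+ j * 'C(n, j)%:R * (4 * m %| 3 * n - 2 * j)%N%:R
  = (-1) ^+ m * 'C(2 * m, m)%:R :> rat.
Proof.
move=> nE; have lt_mn : (m < n.+1)%N by lia.
rewrite (bigD1 (Ordinal lt_mn)) //= big1 ?addr0 => [|j ne_j].
  have -> : (3 * n - 2 * m = 4 * m)%N by lia.
  by rewrite dvdnn mulr1 nE.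
have ne_jm : (j != m :> nat)%N by exact: ne_j.
have lt_j := ltn_ord j.
suff -> : (4 * m %| 3 * n - 2 * j)%N = false by rewrite mulr0.
by apply/negbTE/negP => /dvdnP[k]; case: k => [|[|k]]; lia.
Qed.

Let sum_triple n : n = (6 * m)%N ->
  \sum_(j < n.+1) (-1) ^+ j * 'C(n, j)%:R * (4 * m %| 3 * n - 2 * j)%N%:R
  = (-1) ^+ m * (2%:R * 'C(6 * m, m)%:R + 'C(6 * m, 3 * m)%:R) :> rat.
Proof.
move=> nE; have lt1 : (m < n.+1)%N by lia.
have lt3 : (3 * m < n.+1)%N by lia.
have lt5 : (5 * m < n.+1)%N by lia.
rewrite (bigD1 (Ordinal lt1)) //= (bigD1 (Ordinal lt3)) /=; last first.
  by rewrite -val_eqE /=; lia.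
rewrite (bigD1 (Ordinal lt5)) /=; last by rewrite -!val_eqE /=; lia.
rewrite big1 ?addr0 => [|j /andP[/andP[n1 n3] n5]].
  have -> : (3 * n - 2 * m = 4 * (4 * m))%N by lia.
  have -> : (3 * n - 2 * (3 * m) = 3 * (4 * m))%N by lia.
  have -> : (3 * n - 2 * (5 * m) = 2 * (4 * m))%N by lia.
  have d k : (4 * m %| k * (4 * m))%N = true by rewrite dvdn_mull.
  rewrite !d nE bin_rev.
  have e k : odd k -> (-1) ^+ (k * m) = (-1) ^+ m :> rat.
    by move=> k_odd; rewrite -signr_odd oddM k_odd signr_odd.
  by rewrite (e 3) // (e 5) // !mulr1; ring.
have m1 : (j != m :> nat)%N by exact: n1.
have m3 : (j != 3 * m :> nat)%N by exact: n3.
have m5 : (j != 5 * m :> nat)%N by exact: n5.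
have lt_j := ltn_ord j.
suff -> : (4 * m %| 3 * n - 2 * j)%N = false by rewrite mulr0.
by apply/negbTE/negP => /dvdnP[k]; case: k => [|[|[|[|[|k]]]]]; try lia; nia.
Qed.

(** By [legendre_eqloc] twice the character of z is 3 z^(2 m) - z^(6 m) modulo p^2, so two power
    sums suffice. *)
Theorem jacobsthal_sum_eqloc :
  eqloc p 2 (2%:R * (jacobsthal_sum m.*2 (1 : F))%:~R)
    ((P - 1) * (-1) ^+ m * (3%:R * 'C(2 * m, m)%:R - 2%:R * 'C(6 * m, m)%:R
                            - 'C(6 * m, 3 * m)%:R)).
Proof.
have zF i : (z i)%:~R = (g ^+ i) ^+ 3 - 1 * g ^+ i :> F.
  by rewrite /z rmorphB rmorphXn /= -!pmulrn natrX G_Fp mul1r.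
have -> : jacobsthal_sum m.*2 (1 : F) = \sum_(i < 4 * m) legendre m.*2 ((z i)%:~R : F).
  rewrite /jacobsthal_sum (bigD1 0) //= expr0n mulr0 subr0 legendre0 add0r.
  rewrite (sum_nonzero p_prime pN g_prim); have -> : m.*2.*2 = (4 * m)%N by lia.
  by apply: eq_bigr => i _; rewrite zF.
rewrite rmorph_sum /= mulr_sumr.
apply: (@eqloc_trans _ _ (\sum_(i < 4 * m) (z i)%:~R ^+ m.*2 * (3%:R - (z i)%:~R ^+ (2 * m.*2)))).
  by apply: eqloc_sum => i _; apply: eqloc_sym; apply: legendre_eqloc.
have -> : \sum_(i < 4 * m) (z i)%:~R ^+ m.*2 * (3%:R - (z i)%:~R ^+ (2 * m.*2))
   = 3%:R * \sum_(i < 4 * m) (z i)%:~R ^+ (2 * m) - \sum_(i < 4 * m) (z i)%:~R ^+ (6 * m) :> rat.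
  rewrite mulr_sumr -sumrB; apply: eq_bigr => i _.
  rewrite mulrBr -exprD mulrC; congr (_ * _ ^+ _ - _ ^+ _); lia.
have := cubic_power_sum (6 * m); rewrite sum_triple // => e6.
have := cubic_power_sum (2 * m); rewrite sum_single // => e2.
apply: eqloc_trans (eqlocB (eqlocMl (rpred_nat _ 3) e2) e6) _.
have -> : P - 1 = (4 * m)%:R by rewrite pm -natr1 addrK.
move: ((4 * m)%:R : rat) ((-1) ^+ m : rat) ('C(2 * m, m)%:R : rat) => x s b.
move: ('C(6 * m, m)%:R : rat) ('C(6 * m, 3 * m)%:R : rat) => c d.
have -> : x * s * (3%:R * b - 2%:R * c - d) = 3%:R * (x * (s * b)) - x * (s * (2%:R * c + d)).
  by ring.
exact: eqloc_refl.
Qed.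

End TeichmullerSum.

(** * Primes congruent to 1 modulo 4 *)

Section FactorialProducts.
Implicit Types (a k m : nat).

Lemma fact_up a k : (a + k)`!%:R = a`!%:R * \prod_(i < k) (a%:R + i.+1%:R) :> rat.
Proof.
elim: k => [|k IHk]; first by rewrite big_ord0 addn0 mulr1.
by rewrite addnS factS big_ord_recr /= mulrA -IHk natrM mulrC -natrD addnS.
Qed.

Lemma fact_down a k : (a + k)`!%:R = a`!%:R * \prod_(i < k) ((a + k)%:R - i%:R) :> rat.
Proof.
rewrite fact_up (reindex_inj rev_ord_inj) /=; congr (_ * _); apply: eq_bigr => i _.
by rewrite -natr1 natrB ?ltn_ord // natrD -natr1; ring.
Qed.

Lemma bin_central_fact m : 'C(2 * m, m)%:R * m`!%:R ^+ 2 = (2 * m)`!%:R :> rat.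
Proof.
have := @bin_fact (2 * m) m; have -> : (2 * m - m = m)%N by lia.
by move=> <-; [rewrite !natrM; ring | lia].
Qed.

Lemma harm_add a k : harm (a + k) = harm a + \sum_(i < k) (a%:R + i.+1%:R)^-1.
Proof.
rewrite /harm big_split_ord /=; congr (_ + _); apply: eq_bigr => i _.
by rewrite -natrD addnS.
Qed.

End FactorialProducts.

Section OneModFour.
Variables p m : nat.
Hypothesis p_prime : prime p.
Hypothesis pm : p = (4 * m).+1.
Hypothesis p_gt3 : (3 < p)%N.
Local Notation P := (p%:R : rat).
Local Notation q := (fermat_quotient2 p).
Local Notation C := ('C(2 * m, m)%:R : rat).

Let m_gt0 : (0 < m)%N. Proof. by move: p_gt3; rewrite pm; lia. Qed.

Local Ltac mlia := clear - pm m_gt0 p_gt3; lia.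

Let PE : P = 4%:R * m%:R + 1. Proof. by rewrite pm -natr1 natrM. Qed.

Let Zsmall a : (0 < a < p)%N -> a%:R^-1 \in Zloc p.
Proof. exact: Zloc_small_natV. Qed.

Let Zharm k : (k < p)%N -> harm k \in Zloc p.
Proof. by move=> h; rewrite rpred_sum // => i _; apply: Zsmall; have := ltn_ord i; lia. Qed.

Let Zodd_harm k : (k.*2 <= p)%N -> odd_harm k \in Zloc p.
Proof. by move=> h; rewrite rpred_sum // => i _; apply: Zsmall; have := ltn_ord i; lia. Qed.

Let Z2 := Zloc_2V p_prime p_gt3.
Let Zq := fermat_quotient2_Zloc p_prime p_gt3.

Lemma harm_full : eqloc p 1 (harm (4 * m)) 0.
Proof.
have z2 : 2%:R != 0 :> rat by [].
apply: (eqloc_cancel z2 Z2); rewrite mulr0 mulr_natl mulr2n.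
rewrite -[X in eqloc _ _ _ X](subrr (harm (4 * m))); apply: eqlocD; first exact: eqloc_refl.
rewrite {1}/harm (reindex_inj rev_ord_inj) /= /harm -sumrN; apply: eqloc_sum => j _.
have lt_j := ltn_ord j.
have -> : (4 * m - j.+1).+1 = (p - j.+1)%N by lia.
by apply: eqloc_neg_inv => //; lia.
Qed.

Let D := harm (2 * m) - harm m.

(** The two products for powers of 2 give q = - 2 [odd_harm m] and q = - [harm (2 * m)] / 2 modulo
    p. As D = 2 [odd_harm m] - [harm (2 * m)], these combine to D = - q + 2 q. *)
Lemma exp2_1mod4 : exists u, [/\ 2%:R ^+ (2 * m) = (-1) ^+ m * u,
  eqloc p 2 u (1 + P * (q / 2%:R)) & eqloc p 1 D q].
Proof.
have e := @exp2_sum_prod m m; rewrite eqxx in e; have {e} := e isT.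
have -> : (m + m).*2.+1 = p by lia.
set u := \prod_(i < m) _ => e; exists u.
have hu : eqloc p 2 u (1 + P * - odd_harm m).
  rewrite /u; under eq_bigr => i _ do rewrite -mulrN.
  rewrite -[X in 1 + P * X]sumrN; apply: prod_one_plus => // i _.
  by rewrite rpredN; apply: Zsmall; have := ltn_ord i; lia.
have e2 : 2%:R ^+ (2 * m) = (-1) ^+ m * u by rewrite -e; congr (_ ^+ _); lia.
have sq : u ^+ 2 = 1 + P * q.
  rewrite -(fermat_quotient2E p_prime); have -> : p.-1 = (2 * m * 2)%N by lia.
  by rewrite exprM e2 exprMn sqrr_sign mul1r.
have Zo : odd_harm m \in Zloc p by apply: Zodd_harm; lia.
have Zu : u \in Zloc p by apply: eqloc_Zloc hu _ => //; zloc.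
have q1 : eqloc p 1 q (- (2%:R * odd_harm m)).
  apply: (@eqloc_divP _ p_prime 1 1); rewrite expr1.
  have -> : P * q = u ^+ 2 - 1 by rewrite sq; ring.
  apply: (@eqloc_trans _ _ ((1 + P * - odd_harm m) ^+ 2 - 1)).
    by apply: eqlocB; [apply: eqlocX => //; zloc | exact: eqloc_refl].
  by apply/(eqlocP p_prime); exists (odd_harm m ^+ 2); [zloc | ring].
have q2 : eqloc p 1 q (- (harm (2 * m) / 2%:R)).
  have Zh : harm (2 * m) / 2%:R \in Zloc p by rewrite rpredM ?Zharm //; lia.
  apply: (@eqloc_trans _ _ (odd_harm (2 * m))).
    apply: (@eqloc_divP _ p_prime 1 1); rewrite expr1.
    have -> : P * q = 2%:R ^+ p.-1 - 1 by rewrite fermat_quotient2E //; ring.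
    have -> : p.-1 = (2 * m).*2 by lia.
    rewrite exp2_double_prod; have -> : (2 * m).*2.+1 = p by lia.
    have -> : P * odd_harm (2 * m) = 1 + P * odd_harm (2 * m) - 1 by ring.
    apply: eqlocB; last exact: eqloc_refl.
    by apply: prod_one_plus => // i _; apply: Zsmall; have := ltn_ord i; lia.
  rewrite odd_harmE -[X in eqloc _ _ _ X]add0r; apply: eqlocB; last exact: eqloc_refl.
  have -> : (2 * m).*2 = (4 * m)%N by lia.
  exact: harm_full.
split=> //.
  apply: eqloc_trans hu _; apply: eqlocD; first exact: eqloc_refl.
  apply: (@eqloc_mulP _ p_prime 1 1).
  have -> : - odd_harm m = 2%:R^-1 * - (2%:R * odd_harm m) by field.
  by rewrite mulrC; apply: eqlocMr => //; apply: eqloc_sym.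
have -> : D = - - (2%:R * odd_harm m) + 2%:R * - (harm (2 * m) / 2%:R).
  by rewrite odd_harmE /D -mul2n; field.
have -> : q = - q + 2%:R * q by ring.
apply: eqlocD; first by apply: eqlocN; apply: eqloc_sym.
by apply: eqlocMl; [exact: rpred_nat | exact: eqloc_sym].
Qed.

Let Zfact k : (k < p)%N -> k`!%:R^-1 \in Zloc p.
Proof.
elim: k => [|k IHk] lt_kp; first by rewrite invr1 rpred1.
by rewrite factS natrM invfM rpredM ?IHk ?Zsmall // ltnW.
Qed.

Let C_neq0 : C != 0. Proof. by rewrite pnatr_eq0 -lt0n bin_gt0; mlia. Qed.

Let ZCV : C^-1 \in Zloc p.
Proof.
have -> : C^-1 = m`!%:R ^+ 2 / (2 * m)`!%:R.
  by rewrite -bin_central_fact; field; rewrite C_neq0 fact_neq0.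
by rewrite rpredM ?rpredX ?rpred_nat ?Zfact //; mlia.
Qed.

Let inv_2m : (2 * m)%N%:R^-1 = - 2%:R + P * (2 * m)%N%:R^-1 :> rat.
Proof.
have m0 : m%:R != 0 :> rat by rewrite pnatr_eq0 -lt0n.
by rewrite PE natrM; field.
Qed.

Let Zinv_2m : (2 * m)%N%:R^-1 \in Zloc p. Proof. by apply: Zsmall; mlia. Qed.

Let inv_2m_mod : eqloc p 1 (2 * m)%N%:R^-1 (- 2%:R).
Proof. by apply/(eqlocP p_prime); exists (2 * m)%N%:R^-1; rewrite ?expr1. Qed.

Let harm_pred k : (0 < k)%N -> harm k.-1 = harm k - k%:R^-1.
Proof. by case: k => // k _; rewrite /harm big_ord_recr /= addrK. Qed.

Let half_fact : 2%:R * m`!%:R * \prod_(i < m) (m + i)%N%:R = (2 * m)`!%:R :> rat.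
Proof.
have := fact_up m.-1 m; have -> : (m.-1 + m = (2 * m).-1)%N by mlia.
have -> : (2 * m)`! = (2 * m * (2 * m).-1`!)%N by rewrite -{1 2}(@prednK (2 * m)) ?factS //; mlia.
have -> : m`! = (m * m.-1`!)%N by rewrite -{1 2}(prednK m_gt0) factS.
rewrite !natrM => ->.
rewrite (eq_bigr (fun i : 'I_m => m.-1%:R + i.+1%:R)) => [|i _]; last first.
  by rewrite -natrD; congr (_%:R); mlia.
by ring.
Qed.

(** The numerator factors 5 m + i + 1 are p + (m + i), and the product of the m + i is half of (2
    m)! / m!. The sum of their inverses is D + 1 / (2 m), where 1 / (2 m) = - 2 modulo p. *)
Lemma bin6_side : eqloc p 1 D q ->
  eqloc p 2 (2%:R * 'C(6 * m, m)%:R) (C * (1 + P * (q - 2%:R))).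
Proof.
move=> Dq.
have -> : 2%:R * 'C(6 * m, m)%:R = C * \prod_(i < m) (1 + P * (m + i)%N%:R^-1).
  have f5 := fact_neq0 (5 * m); have f1 := fact_neq0 m.
  have e : 'C(6 * m, m)%:R * m`!%:R
         = \prod_(i < m) (m + i)%N%:R * \prod_(i < m) (1 + P * (m + i)%N%:R^-1) :> rat.
    rewrite -big_split /= (eq_bigr (fun i : 'I_m => (5 * m)%:R + i.+1%:R)) => [|i _]; last first.
      have h0 : (m + i)%:R != 0 :> rat by rewrite pnatr_eq0; mlia.
      by rewrite mulrDr mulr1 mulrCA divff // mulr1 -!natrD pm; congr (_%:R); mlia.
    apply: (mulfI f5); rewrite -fact_up -!natrM; congr (_%:R).
    have <- : (6 * m = 5 * m + m)%N by mlia.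
    rewrite -[RHS](@bin_fact (6 * m) m); last by mlia.
    have -> : (6 * m - m = 5 * m)%N by mlia.
    by rewrite mulnC -mulnA.
  apply: (mulIf (_ : m`!%:R ^+ 2 != 0)); first by rewrite expf_neq0.
  transitivity (2%:R * m`!%:R * ('C(6 * m, m)%:R * m`!%:R) : rat); first by ring.
  rewrite e mulrA half_fact -bin_central_fact; ring.
apply: eqlocMl; first exact: rpred_nat.
have Zi (i : 'I_m) : (m + i)%N%:R^-1 \in Zloc p by apply: Zsmall; have := ltn_ord i; mlia.
apply: eqloc_trans (prod_one_plus p_prime (fun i _ => Zi i)) _.
apply: eqlocD; first exact: eqloc_refl.
apply: (@eqloc_mulP _ p_prime 1 1).
have -> : \sum_(i < m) (m + i)%N%:R^-1 = D + (2 * m)%N%:R^-1.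
  have := harm_add m.-1 m; have -> : (m.-1 + m = (2 * m).-1)%N by mlia.
  rewrite !harm_pred //; last by mlia.
  rewrite (eq_bigr (fun i : 'I_m => (m + i)%N%:R^-1)) => [e|i _]; last first.
    by rewrite -natrD; congr (_%:R^-1); mlia.
  have m0 : m%:R != 0 :> rat by rewrite pnatr_eq0 -lt0n.
  have {e} -> : \sum_(i < m) (m + i)%N%:R^-1 = harm (2 * m) - (2 * m)%:R^-1 - (harm m - m%:R^-1).
    by rewrite e; ring.
  by rewrite /D natrM; field.
by apply: eqlocD.
Qed.

Let prod_subP k a : (k + a < p)%N ->
  exists2 w, eqloc p 2 w (1 - P * (harm (a + k) - harm a)) &
    \prod_(i < k) (P - (a + i.+1)%N%:R) = (-1) ^+ k * ((a + k)`!%:R / a`!%:R) * w.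
Proof.
move=> lt_kap; exists (\prod_(i < k) (1 + P * - (a + i.+1)%N%:R^-1)).
  have Zi (i : 'I_k) : - (a + i.+1)%N%:R^-1 \in Zloc p.
    by rewrite rpredN; apply: Zsmall; have := ltn_ord i; lia.
  apply: eqloc_trans (prod_one_plus p_prime (fun i _ => Zi i)) _.
  rewrite sumrN -mulrN harm_add.
  under eq_bigr => i _ do rewrite natrD.
  by rewrite [harm a + _]addrC addrK eqloc_refl.
have f0 := fact_neq0 a; rewrite fact_up [_ * _ / _]mulrAC divff // mul1r.
rewrite -[k in (-1) ^+ k]card_ord -prodrN -big_split /=; apply: eq_bigr => i _.
have h0 : (a + i.+1)%:R != 0 :> rat by rewrite pnatr_eq0 addnS.
rewrite -natrD; move: ((a + i.+1)%:R : rat) P h0 => y x y0; by field.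
Qed.

(** Measured from p, the factors of (4 m)! / (3 m)! and (3 m)! / (2 m)! are p - 1, ..., p - m and p
    - m - 1, ..., p - 2 m, and those of (6 m)! / (4 m)! are p, ..., p + 2 m - 1. The quotient w1 w2
    / w3 then has p-coefficient 2 D - 1 / (2 m). *)
Lemma bin6_middle : eqloc p 1 D q -> exists2 K, K \in Zloc p &
  'C(6 * m, 3 * m)%:R = P * K /\
  eqloc p 2 (K * C * (2 * m)%:R) (1 + P * (2%:R * q + 2%:R)).
Proof.
move=> Dq.
have [w1 w1P e1] := @prod_subP m 0 ltac:(mlia).
have [w3 w3P e3] := @prod_subP m m ltac:(mlia).
pose w2 := \prod_(i < (2 * m).-1) (1 + P * i.+1%:R^-1).
have Zi (i : 'I_(2 * m).-1) : i.+1%:R^-1 \in Zloc p by apply: Zsmall; have := ltn_ord i; mlia.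
have w2P : eqloc p 2 w2 (1 + P * harm (2 * m).-1).
  by apply: prod_one_plus => // i _; apply: Zi.
have e2 : \prod_(i < (2 * m).-1) (P + i.+1%:R) = (2 * m).-1`!%:R * w2.
  have := fact_up 0 (2 * m).-1; rewrite add0n mul1r => ->.
  rewrite -big_split /=; apply: eq_bigr => i _.
  have h0 : i.+1%:R != 0 :> rat by rewrite pnatr_eq0.
  by rewrite add0r mulrDr mulr1 mulrCA divff // mulr1 addrC.
have f4 : (4 * m)`!%:R = (3 * m)`!%:R * \prod_(i < m) (P - (0 + i.+1)%N%:R).
  have := fact_down (3 * m) m; have -> : (3 * m + m = 4 * m)%N by mlia.
  move=> ->; congr (_ * _); apply: eq_bigr => i _.
  by rewrite add0n PE -natr1 natrM; ring.
have f3 : (3 * m)`!%:R = (2 * m)`!%:R * \prod_(i < m) (P - (m + i.+1)%N%:R).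
  have := fact_down (2 * m) m; have -> : (2 * m + m = 3 * m)%N by mlia.
  move=> ->; congr (_ * _); apply: eq_bigr => i _.
  by rewrite PE natrD -natr1 natrM; ring.
have f6 : (6 * m)`!%:R = (4 * m)`!%:R * (P * \prod_(i < (2 * m).-1) (P + i.+1%:R)).
  have := fact_up (4 * m) (2 * m); have -> : (4 * m + 2 * m = 6 * m)%N by mlia.
  move=> ->; congr (_ * _); have -> : (2 * m = (2 * m).-1.+1)%N by mlia.
  rewrite big_ord_recl /=; congr (_ * _); first by rewrite pm natr1.
  by apply: eq_bigr => i _; rewrite -!natrD pm; congr (_%:R); rewrite /bump /=; mlia.
have w1u : w1 \in Zloc p.
  by apply: eqloc_Zloc w1P _ => //; rewrite rpredB ?rpred1 // rpredM ?rpred_nat // rpredB ?Zharm //; mlia.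
have [w30 Zw3] : w3 != 0 /\ w3^-1 \in Zloc p.
  apply: one_unit => //; apply: eqloc_trans (@eqloc_weak _ p_prime 1 2 _ _ isT w3P) _.
  apply: eqloc_Dzero; rewrite -mulrN -{1}[P]expr1; apply: eqloc_zero => //.
  by rewrite rpredN rpredB ?Zharm //; mlia.
have Zw2 : w2 \in Zloc p by rewrite rpred_prod // => i _; rewrite rpredD ?rpred1 ?rpredM ?rpred_nat.
have d0 : (2 * m)%:R != 0 :> rat by rewrite pnatr_eq0; mlia.
exists (w1 * w2 / (w3 * C * (2 * m)%:R)).
  by rewrite !invfM !rpredM.
split.
  have F0 := fact_neq0 (3 * m); have M0 := fact_neq0 m.
  have e6 : 'C(6 * m, 3 * m)%:R * (3 * m)`!%:R = (-1) ^+ m * m`!%:R * w1 * (P * ((2 * m).-1`!%:R * w2)).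
    apply: (mulIf F0); move: f6; rewrite f4 e1 e2 add0n divr1 => f6.
    transitivity ((6 * m)`!%:R : rat); last by rewrite f6; ring.
    rewrite -!natrM; congr (_%:R); rewrite -[RHS](@bin_fact (6 * m) (3 * m)); last by mlia.
    have -> : (6 * m - 3 * m = 3 * m)%N by mlia.
    by rewrite mulnA.
  move: e6; rewrite f3 e3 addnn -mul2n.
  have eF : (2 * m)`! = (2 * m * (2 * m).-1`!)%N by rewrite -{1 2}(@prednK (2 * m)) ?factS //; mlia.
  have eC : C * m`!%:R ^+ 2 = (2 * m)%:R * (2 * m).-1`!%:R.
    by rewrite bin_central_fact eF natrM.
  rewrite eF natrM.
  have H0 := fact_neq0 (2 * m).-1.
  have s0 : (-1) ^+ m != 0 :> rat by rewrite signr_eq0.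
  move: eC d0 C_neq0 s0 M0 H0 w30 => eC d0 c0 s0 M0 H0 x30 e6.
  have Hdef : (2 * m).-1`!%:R = C * m`!%:R ^+ 2 / (2 * m)%:R by rewrite eC mulrAC divff ?mul1r.
  move: e6; rewrite Hdef.
  move: C c0 d0 s0 M0 x30 {H0 eC Hdef} => c c0.
  move: ((2 * m)%:R : rat) => d d0; move: ((-1) ^+ m : rat) => s s0.
  move: (m`!%:R : rat) => M M0 x30.
  move: ('C(6 * m, 3 * m)%:R : rat) P => b x e6.
  have k1 : c * M ^+ 2 * (s * (c * M ^+ 2) / M) * w3 != 0.
    by rewrite !mulf_neq0 ?invr_eq0 ?expf_neq0 ?mulf_neq0 ?expf_neq0.
  apply: (mulIf k1).
  transitivity (b * (d * (c * M ^+ 2 / d) * ((-1) ^+ 0 * s * (d * (c * M ^+ 2 / d) / M) * w3))).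
    by field; rewrite d0 M0.
  rewrite expr0 mul1r e6; field; rewrite x30 c0 d0 M0 //.
have -> : w1 * w2 / (w3 * C * (2 * m)%:R) * C * (2 * m)%:R = w3^-1 * (w1 * w2).
  by move: ((2 * m)%:R : rat) d0 => d d0; field; rewrite w30 C_neq0 d0.
apply: (eqloc_cancel w30 Zw3); rewrite mulVKf //.
have Zh1 : harm m \in Zloc p by apply: Zharm; mlia.
have Zh2 : harm (2 * m) \in Zloc p by apply: Zharm; mlia.
have h0 : harm 0 = 0 by rewrite /harm big_ord0.
rewrite add0n h0 subr0 in w1P; rewrite addnn -mul2n -/D in w3P.
rewrite harm_pred in w2P; last by mlia.
have ZD : D \in Zloc p by rewrite rpredB.
have Dq' : eqloc p 1 (2%:R * q + 2%:R) (2%:R * D - (2 * m)%:R^-1).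
  apply: eqlocD; last by rewrite -[X in eqloc _ _ X _]opprK; apply: eqlocN; apply: eqloc_sym.
  by apply: eqlocMl; [exact: rpred_nat | exact: eqloc_sym].
apply: eqloc_trans (eqlocM _ Zw2 w1P w2P) _; first by zloc.
apply: eqloc_sym.
apply: eqloc_trans (eqlocMr _ w3P) _; first by zloc.
apply: eqloc_trans (eqlocMl _ (eqlocD (eqloc_refl p 2 1) (@eqloc_mulP _ p_prime 1 1 _ _ Dq'))) _.
  by zloc.
rewrite expr1; have -> : harm (2 * m) = D + harm m by rewrite /D subrK.
move: (harm m) D ((2 * m)%:R^-1) Zh1 ZD Zinv_2m {Dq' Dq w1P w2P w3P Zh2} => h d v Zh Zd Zv.
apply/(eqlocP p_prime); exists (- (d * (2%:R * d - v)) + h * (d + h - v)); first by zloc.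
by ring.
Qed.

End OneModFour.

(** * From C(2 m, m) to x, and the sum for p = 4 m + 1 *)

Section OneModFourFinal.
Variables p m : nat.
Hypothesis p_prime : prime p.
Hypothesis pm : p = (4 * m).+1.
Hypothesis p_gt3 : (3 < p)%N.
Variables x y : int.
Hypothesis p_xy : p%:Z = x ^+ 2 + y ^+ 2.
Hypothesis x_mod4 : (4 %| x - 1)%Z.
Local Notation P := (p%:R : rat).
Local Notation q := (fermat_quotient2 p).
Local Notation C := ('C(2 * m, m)%:R : rat).
Local Notation X := (2%:R * x%:~R : rat).

(** K is still present here. Once it is eliminated in [reciprocal_eqloc], the relation amounts to
    the familiar C = (1 + p q / 2) (2 x - p / (2 x)) modulo p^2. *)
Lemma chowla_dwork_evans K : K \in Zloc p ->
  'C(6 * m, 3 * m)%:R = P * K ->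
  eqloc p 2 (2%:R * 'C(6 * m, m)%:R) (C * (1 + P * (q - 2%:R))) ->
  eqloc p 2 (2%:R * X) (- ((P - 1) * (3%:R * C - C * (1 + P * (q - 2%:R)) - P * K))).
Proof.
move=> ZK eK e6.
have m_gt0 : (0 < m)%N by move: p_gt3; rewrite pm; clear; lia.
have pN : p = m.*2.*2.+1 by rewrite pm; clear; lia.
have [g g_prim] := Fp_primitive_root p_prime pN.
have := jacobsthal_sum_eqloc p_prime pm m_gt0 g_prim.
rewrite (jacobsthal_sum_two_squares p_prime pm g_prim p_xy x_mod4) eK.
rewrite rmorphN rmorphM rmorphM rmorph_sign /= => eS.
have {}eS := eqlocMl (_ : - (-1) ^+ m \in Zloc p) eS.
have ss : (-1) ^+ m * (-1) ^+ m = 1 :> rat by rewrite -expr2 sqrr_sign.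
have -> : 2%:R * X = - (-1) ^+ m * (2%:R * - ((-1) ^+ m * X)).
  transitivity (((-1) ^+ m * (-1) ^+ m) * (2%:R * X)); first by rewrite ss mul1r.
  by ring.
apply: eqloc_trans (eS _) _; first by rewrite rpredN rpred_sign.
have -> : - (-1) ^+ m * ((P - 1) * (-1) ^+ m * (3%:R * C - 2%:R * 'C(6 * m, m)%:R - P * K))
   = - ((P - 1) * (3%:R * C - 2%:R * 'C(6 * m, m)%:R - P * K)).
  transitivity (- (((-1) ^+ m * (-1) ^+ m) * ((P - 1) * (3%:R * C - 2%:R * 'C(6 * m, m)%:R - P * K)))).
    by ring.
  by rewrite ss mul1r.
apply: eqlocN; apply: eqlocMl; first by rewrite rpredB ?rpred1 ?rpred_nat.
by apply: eqlocB; [apply: eqlocB => //; exact: eqloc_refl | exact: eqloc_refl].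
Qed.

(* Here c, k, u, w and r stand for C(2 m, m), C(6 m, 3 m) / p, (-1)^m 2^(2 m),
   2 x and the Fermat quotient. *)
Lemma reciprocal_eqloc (c k u w r : rat) :
  c \in Zloc p -> c != 0 -> c^-1 \in Zloc p -> k \in Zloc p -> r \in Zloc p ->
  eqloc p 2 (k * c * ((P - 1) / 2%:R)) (1 + P * (2%:R * r + 2%:R)) ->
  eqloc p 2 u (1 + P * (r / 2%:R)) ->
  eqloc p 2 (2%:R * w) (- ((P - 1) * (3%:R * c - c * (1 + P * (r - 2%:R)) - P * k))) ->
  [/\ w != 0, w^-1 \in Zloc p &
    eqloc p 2 (k * ((3%:R * P - 1) / 2%:R) / u ^+ 3) (w^-1 + P * w^-1 ^+ 3)].
Proof.
move=> Zc c0 ZcV Zk Zr.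
have Z2 := Zloc_2V p_prime p_gt3; have ZP : P \in Zloc p by exact: rpred_nat.
have z2 : 2%:R != 0 :> rat by [].
case/(eqlocP p_prime)=> b Zb eb /(eqlocP p_prime)[a Za ea] /(eqlocP p_prime)[d Zd ed].
have [u0 Zu] : u != 0 /\ u^-1 \in Zloc p.
  apply: one_unit => //; apply/(eqlocP p_prime); exists (r / 2%:R + P * a); first by zloc.
  by rewrite ea; ring.
have Zuu : u \in Zloc p by rewrite ea; zloc.
pose v := c^-1; have Zv : v \in Zloc p by []; have cv : c * v = 1 by rewrite divff.
(* Since (P - 1) (P + 1) = P^2 - 1, dividing by (P - 1) / 2 is multiplying by - 2 (P + 1) modulo
   P^2; k1 gathers the error. *)
pose k1 := k - 2%:R * v * (2%:R * r + 2%:R) - 2%:R * v * (P + 1) * b.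
have Zk1 : k1 \in Zloc p by rewrite /k1; zloc.
have ek : k = - 2%:R * v * (1 + 3%:R * P + 2%:R * P * r) + P ^+ 2 * k1.
  have h : k * (P ^+ 2 - 1) = 2%:R * v * (P + 1) * (1 + P * (2%:R * r + 2%:R) + P ^+ 2 * b).
    by rewrite -eb /v; field.
  have -> : k = k * P ^+ 2 - k * (P ^+ 2 - 1) by ring.
  by rewrite h /k1; ring.
clearbody k1.
have [w2 Zw2 ew] : exists2 w2, w2 \in Zloc p & w = c - c * P * r / 2%:R + P * v + P ^+ 2 * w2.
  exists (2%:R^-1 * (d + c * (r - 2%:R) + k + 2%:R * v * (3%:R + 2%:R * r) - P * k1)).
    by zloc.
  by apply: (mulfI z2); rewrite ed ek; field.
have [w0 ZwV] : w != 0 /\ w^-1 \in Zloc p.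
  apply: (eqloc1_unit p_prime c0 ZcV) => //; apply/(eqlocP p_prime).
  by exists (- c * r / 2%:R + v + P * w2); [zloc | rewrite ew; field].
split=> //.
(* First-order inversion of w = c (1 - P r / 2 + P v^2), with v = 1 / c. *)
have inv_w : eqloc p 2 w^-1 (v * (1 + P * (r / 2%:R)) - P * v ^+ 3).
  apply: (eqloc_cancel w0 ZwV); rewrite divff //; apply: eqloc_sym; apply/(eqlocP p_prime).
  exists (w2 * (v * (1 + P * (r / 2%:R)) - P * v ^+ 3)
          + (- c * r / 2%:R + v) * (v * (r / 2%:R) - v ^+ 3)); first by zloc.
  transitivity (c * v * (1 + P * (r / 2%:R)) - P * v * (v * (c * v) - v) - P * (c * v) * r / 2%:R
    + P ^+ 2 * (w2 * (v * (1 + P * (r / 2%:R)) - P * v ^+ 3)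
          + (- c * r / 2%:R + v) * (v * (r / 2%:R) - v ^+ 3))).
    by rewrite {1}ew; field.
  by rewrite cv; field.
have inv_w1 : eqloc p 1 w^-1 v.
  apply: eqloc_trans (@eqloc_weak _ p_prime 1 2 _ _ isT inv_w) _.
  by apply/(eqlocP p_prime); exists (v * (r / 2%:R) - v ^+ 3); [zloc | ring].
(* The term P w^-3 cancels the - P v^3 of [inv_w]. On the other side (1 + 3 P + 2 P r) (1 - 3 P) (1
   - 3 P r / 2) also gives 1 + P r / 2. *)
apply: (@eqloc_trans _ _ (v * (1 + P * (r / 2%:R)))); last first.
  apply: eqloc_sym; have -> : v * (1 + P * (r / 2%:R)) = (v * (1 + P * (r / 2%:R)) - P * v ^+ 3) + P * v ^+ 3.
    by rewrite subrK.
  apply: eqlocD => //; apply: (@eqloc_mulP _ p_prime 1 1); exact: eqlocX.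
have u30 : u ^+ 3 != 0 by rewrite expf_neq0.
apply: (eqloc_cancel u30); first by rewrite -exprVn rpredX.
rewrite mulrC divfK //; apply: eqloc_sym.
apply: (@eqloc_trans _ _ ((1 + P * (r / 2%:R)) ^+ 3 * (v * (1 + P * (r / 2%:R))))).
  apply: eqlocMr; first by zloc.
  apply: eqlocX => //; first by zloc.
  by apply/(eqlocP p_prime); exists a.
apply/(eqlocP p_prime).
exists (v * (6%:R * (r / 2%:R) ^+ 2 + 4%:R * P * (r / 2%:R) ^+ 3 + P ^+ 2 * (r / 2%:R) ^+ 4)
   + v * (9%:R + 6%:R * r) - k1 * ((3%:R * P - 1) / 2%:R)).
  by zloc.
by rewrite ek; field.
Qed.

Theorem supercongruence_1mod4 (A : rat) : 4%:R * A = 3%:R ->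
  x != 0 /\ X^-1 \in Zloc p /\
  eqloc p 4 (\sum_(0 <= k < p) (8 * k + 3)%:R * gbinom (- A) k ^+ 4)
    (P ^+ 2 * ((-1) ^+ m * (3%:R * (X^-1 + P * X^-1 ^+ 3)))).
Proof.
move=> A_val.
have [u [e2 uP Dq]] := exp2_1mod4 p_prime pm p_gt3.
have [K ZK [eK KP]] := bin6_middle p_prime pm p_gt3 Dq.
have e6 := bin6_side p_prime pm p_gt3 Dq.
have eX := chowla_dwork_evans ZK eK e6.
have m_gt0 : (0 < m)%N by move: p_gt3; rewrite pm; clear; lia.
have PE : P = 4%:R * m%:R + 1 by rewrite pm -natr1 natrM.
have Zq := fermat_quotient2_Zloc p_prime p_gt3.
have C0 : C != 0 by rewrite pnatr_eq0 -lt0n bin_gt0; clear; lia.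
have ZCV : C^-1 \in Zloc p.
  have coC k : (k < p)%N -> coprime p k`!.
    elim: k => [|k IHk] lt_kp; first exact: coprimen1.
    by rewrite factS coprimeMr IHk 1?ltnW // andbT prime_coprime_small.
  have lt_2mp : (2 * m < p)%N by rewrite pm; clear; lia.
  apply: Zloc_natV; apply: coprime_dvdr (coC _ lt_2mp).
  rewrite -(@bin_fact (2 * m) m); first exact: dvdn_mulr.
  by clear; lia.
have KP' : eqloc p 2 (K * C * ((P - 1) / 2%:R)) (1 + P * (2%:R * q + 2%:R)).
  have -> : (P - 1) / 2%:R = (2 * m)%:R by rewrite PE natrM; field.
  exact: KP.
have [X0 ZXV final] := reciprocal_eqloc (rpred_nat _ _) C0 ZCV ZK Zq KP' uP eX.
split; first by apply: contraNneq X0 => ->; rewrite mulr0.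
split=> //.
pose t := - A - (3 * m)%:R; have t_P : t = P * (- (3%:R / 4%:R)).
  by rewrite /t PE natrM; move: A_val; lra.
apply: eqloc_trans (core_congruence p_prime p_gt3 (n := 3 * m) (e := 3) _ _ A_val (erefl t)) _.
- by rewrite pm; clear; lia.
- by rewrite pm; clear; lia.
have u30 : u ^+ 3 != 0.
  have : 2%:R ^+ (2 * m) != 0 :> rat by rewrite expf_neq0.
  by rewrite e2 mulf_eq0 negb_or => /andP[_ u0]; rewrite expf_neq0.
have Z4 : 4%:R^-1 \in Zloc p by apply: Zloc_natV; rewrite (@coprimeXr 2 p 2) ?coprime_p2.
(* One p comes from t and one from C(6 m, 3 m), so modulo p^2 is enough, and each factor differs
   from 1 by a multiple of t^2. *)
have prod1 : eqloc p 2 (\prod_(j < 3 * m) (1 - t ^+ 2 / cubic_norm t j.+1)) 1.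
  have Zn (j : 'I_(3 * m)) : (cubic_norm t j.+1)^-1 \in Zloc p.
    have Zw : - (3%:R / 4%:R) \in Zloc p by zloc.
    have lt_jp : (j.+1 < p)%N by move: (ltn_ord j); clear - pm; lia.
    by have [] := cubic_norm_inv p_prime t_P Zw lt_jp.
  apply: (big_ind (fun z => eqloc p 2 z 1)) => [|z1 z2 h1 h2|j _]; first exact: eqloc_refl.
    rewrite -[X in eqloc _ _ _ X]mulr1; apply: eqlocM; rewrite ?rpred1 //.
    by apply: eqloc_Zloc h2 _; rewrite ?rpred1.
  apply: eqloc_Dzero; rewrite -mulNr.
  have -> : - t ^+ 2 / cubic_norm t j.+1 = P ^+ 2 * (- (3%:R / 4%:R) ^+ 2 / cubic_norm t j.+1).
    by move: (cubic_norm _ _)^-1 => N; rewrite t_P; ring.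
  by apply: eqloc_zero => //; have ZN := Zn j; zloc.
(* Uses 4^(3 m) = (2^(2 m))^3 = (-1)^m u^3 and 6 m + 1 = (3 p - 1) / 2. *)
have -> : P * 3%:R * ((3 * m).*2.+1%:R * 'C((3 * m).*2, 3 * m)%:R / 4%:R ^+ (3 * m))
   = P ^+ 2 * (3%:R * (-1) ^+ m * (K * ((3%:R * P - 1) / 2%:R) / u ^+ 3)).
  have -> : (3 * m).*2 = (6 * m)%N by clear; lia.
  have -> : 4%:R ^+ (3 * m) = (-1) ^+ m * u ^+ 3 :> rat.
    have -> : 4%:R = 2%:R ^+ 2 :> rat by rewrite -natrX.
    rewrite -exprM; have -> : (2 * (3 * m) = 2 * m * 3)%N by clear; lia.
    rewrite exprM e2 exprMn -exprM mulnC exprM.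
    by have -> : (-1) ^+ 3 = -1 :> rat by [].
  have -> : (6 * m).+1%:R = (3%:R * P - 1) / 2%:R by rewrite PE -natr1 natrM; field.
  rewrite eK -signr_odd; move: (odd m) => b; move: (u ^+ 3) u30 => w w0.
  by case: b; rewrite ?expr0 ?expr1; field.
rewrite -[X in eqloc _ _ X _]mulrA; apply: (@eqloc_mulP _ p_prime 2 2).
have Zrhs : X^-1 + P * X^-1 ^+ 3 \in Zloc p.
  by rewrite rpredD // rpredM ?rpred_nat // rpredX.
have -> : (-1) ^+ m * (3%:R * (X^-1 + P * X^-1 ^+ 3)) = 3%:R * (-1) ^+ m * (X^-1 + P * X^-1 ^+ 3) * 1.
  by ring.
apply: eqlocM => //.
- by rewrite rpredM // rpredM ?rpred_nat ?rpred_sign.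
- by apply: eqloc_Zloc prod1 _; rewrite ?rpred1.
by apply: eqlocMl => //; rewrite rpredM ?rpred_nat ?rpred_sign.
Qed.

End OneModFourFinal.

Theorem theorem5p4 (p : nat) (p_prime : prime p) (p_gt3 : (3 < p)%N) :
  (p = 1 %[mod 4] ->
   forall x y : int, p%:Z = x ^+ 2 + y ^+ 2 -> (4 %| x - 1)%Z ->
   p_congr p (p ^ 4)
     (\sum_(0 <= k < p) (8 * k + 3)%:R * gbinom (- (3%:R / 4%:R)) k ^+ 4)
     ((-1) ^+ ((p - 1) %/ 4)
      * (3%:R * p%:R ^+ 2 / (2%:R * x%:~R)
         + 3%:R * p%:R ^+ 3 / (8%:R * x%:~R ^+ 3))))
  /\
  (p = 3 %[mod 4] ->
   p_congr p (p ^ 4)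
     (\sum_(0 <= k < p) (8 * k + 3)%:R * gbinom (- (3%:R / 4%:R)) k ^+ 4)
     ((-1) ^+ ((p - 3) %/ 4) * p%:R
      * ('C((p - 3) %/ 2, (p - 3) %/ 4))%:R
      * (1 - p%:R * (1 + 1 / 2%:R * fermat_quotient2 p)
         + p%:R ^+ 2 * (1 / 2%:R * fermat_quotient2 p
                        + 3%:R / 8%:R * fermat_quotient2 p ^+ 2
                        + 1 / 4%:R * (euler (p - 3))%:~R)))).
Proof.
have P0 := primeQ_neq0 p_prime.
have A_val : 4%:R * (3%:R / 4%:R) = 3%:R :> rat by [].
have Zq := fermat_quotient2_Zloc p_prime p_gt3.
split=> p_mod.
  move=> x y p_xy x_mod4; set m := ((p - 1) %/ 4)%N.
  have pm : p = (4 * m).+1 by rewrite /m; clear - p_mod p_gt3; lia.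
  have [x0 [ZXV eqS]] := supercongruence_1mod4 p_prime pm p_gt3 p_xy x_mod4 A_val.
  move: eqS; set rhs := (X in eqloc _ _ _ X) => eqS.
  have Zrhs : rhs \in Zloc p.
    rewrite /rhs rpredM ?rpredX ?rpred_nat // rpredM ?rpred_sign // rpredM ?rpred_nat //.
    by rewrite rpredD // rpredM ?rpred_nat // rpredX.
  have <- : rhs = (-1) ^+ m * (3%:R * p%:R ^+ 2 / (2%:R * x%:~R)
                   + 3%:R * p%:R ^+ 3 / (8%:R * x%:~R ^+ 3)).
    have xQ0 : x%:~R != 0 :> rat by rewrite intr_eq0.
    by rewrite /rhs; move: (x%:~R : rat) (p%:R : rat) xQ0 => w P w0; field.
  exact: eqloc_congr p_prime Zrhs eqS.
set n := ((p - 3) %/ 4)%N.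
have pE : (4 * n + 3 = p)%N by rewrite /n; clear - p_mod p_gt3; lia.
have -> : ((p - 3) %/ 2)%N = n.*2 by clear - pE; lia.
apply: (eqloc_congr p_prime); last exact: (supercongruence_3mod4 p_prime p_gt3 pE A_val).
have Z2 := Zloc_2V p_prime p_gt3.
have Z4 : 4%:R^-1 \in Zloc p by apply: Zloc_natV; rewrite (@coprimeXr 2 p 2) ?coprime_p2.
have Z8 : 8%:R^-1 \in Zloc p by apply: Zloc_natV; rewrite (@coprimeXr 3 p 2) ?coprime_p2.
have ZE : ((euler (p - 3))%:~R : rat) \in Zloc p by exact: rpred_int.
by zloc.
Qed.
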